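(* Let $U$ be an $n$-qubit state preparation unitary with $U\ket{0}=\sum_{j=1}^N\psi_j\ket{x_j}$, $N=2^n$, where $\psi_j\in\mathbb{R}_{\ge0}$ for all $j$, $\sum_j\psi_j^2=1$, and $\{x_j\}_j$ is some (unknown) ordering of the computational basis states, with $\psi_1>\psi_2\ge\dots\ge\psi_N$. Let $\Delta:=\psi_1-\psi_2$, and suppose the values $\psi_1$ and $\Delta$ are given. Then, with arbitrarily high probability of success and $\tilde O\big(\frac{1}{\psi_1\Delta}\big)$ queries to controlled-$U$ and controlled-$U^\dagger$ circuits, one can determine the basis state $x_1$ with maximum amplitude.
   Context: $\tilde O(\cdot)$ hides polylogarithmic factors (here in $N$, $1/\psi_1$, $1/\Delta$). *)

(* Defs.v *)
From HB Require Import structures.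
From mathcomp Require Import all_boot all_order all_algebra.
From mathcomp Require Import complex mxtens.
From mathcomp Require Import reals exp.
Set Implicit Arguments. Unset Strict Implicit. Unset Printing Implicit Defensive.
Import Order.TTheory GRing.Theory Num.Theory.
Local Open Scope ring_scope.
Local Open Scope complex_scope.

(* Complex amplitudes over an arbitrary real field R : realType are R[i]. *)
(* Conjugate transpose. *)
Definition adjmx (R : realType) m n (A : 'M[R[i]]_(m, n)) : 'M[R[i]]_(n, m) :=
  (map_mx (fun z : R[i] => z^*) A)^T.

Definition unitary (R : realType) n (A : 'M[R[i]]_n) : Prop :=
  A *m adjmx A = 1%:M /\ adjmx A *m A = 1%:M.

(* the computational basis vector |0...0> *)
Definition ket0 (R : realType) d : 'cV[R[i]]_d := \col_(i < d) (nat_of_ord i == 0)%:R.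

(* A quantum query algorithm on a workspace  (control qubit) x (n-qubit system register)
   x (ancilla of dimension anc).  It alternates arbitrary gates with queries. *)
Record qalg (R : realType) (N : nat) := QAlg {
  anc : nat;
  nq : nat;                                              (* number of queries *)
  gate : 'I_nq.+1 -> 'M[R[i]]_((N + N) * anc);
  dagq : nat -> bool;  (* only indices < nq are used *)      (* true: query controlled-U^dagger, false: controlled-U *)
  outp : 'I_((N + N) * anc) -> 'I_N  (* classical post-processing of the measurement *)
}.

Arguments anc {R N} q.
Arguments nq {R N} q.
Arguments gate {R N} q _.
Arguments dagq {R N} q _.
Arguments outp {R N} q _.

Definition qalg_unitary (R : realType) N (A : qalg R N) : Prop := forall k, unitary (gate A k).

(* controlled-U (or controlled-U^dagger) acting on control+system, identity on ancilla *)
Definition cquery (R : realType) N (U : 'M[R[i]]_N) (b : bool) (anc : nat) : 'M[R[i]]_((N + N) * anc) :=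
  (block_mx 1%:M 0 0 (if b then adjmx U else U)) *t (1%:M : 'M[R[i]]_anc).

Fixpoint qstate (R : realType) N (A : qalg R N) (U : 'M[R[i]]_N) (k : nat) : 'cV[R[i]]_((N + N) * anc A) :=
  match k with
  | 0 => gate A ord0 *m ket0 _ _
  | k'.+1 => gate A (inord k'.+1) *m (cquery U (dagq A k') (anc A) *m qstate A U k')
  end.

Definition final_state (R : realType) N (A : qalg R N) (U : 'M[R[i]]_N) := qstate A U (nq A).

(* probability that measuring the final state in the computational basis
   and post-processing yields x *)
Definition success_prob (R : realType) N (A : qalg R N) (U : 'M[R[i]]_N) (x : 'I_N) : R[i] :=
  \sum_(o | outp A o == x) `|final_state A U o ord0| ^+ 2.

(* Main.v *)
Require Import Defs.
From HB Require Import structures.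
From mathcomp Require Import all_boot all_order all_algebra.
From mathcomp Require Import complex mxtens.
From mathcomp Require Import reals exp.
From mathcomp Require Import topology normedtype derive trigo.
From mathcomp Require Import ring lra zify.
Set Implicit Arguments. Unset Strict Implicit. Unset Printing Implicit Defensive.
Import Order.TTheory GRing.Theory Num.Theory numFieldNormedType.Exports.
Local Open Scope ring_scope.
Local Open Scope complex_scope.

(* For a basis state [a], let [G_a] be the Grover iteration built from
   [U^dagger |a>] and [|0>].  Writing [psi_a = sin theta_a], the overlap
   [<0| G_a^m |0>] is [cos (2 m theta_a)].  Loading [sum_a psi_a |a>] into an
   ancilla and running [G_a^m] with [m] in a superposition prepared as [v] and
   projected on [w] multiplies each amplitude [psi_a] by
   [p(theta_a) = sum_m v_m w_m cos (2 m theta_a)].  The weights are chosen so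
   that [p] is a power of a Fejer kernel peaked at the known angle [theta_1]:
   degree [O(log(1/delta) / Delta)] makes [p] at least of constant size at
   [theta_1] and at most [delta] at all other [theta_a].  Amplitude
   amplification in [O(1 / psi_1)] rounds then brings the amplitude of [x_1] to
   nearly 1; scaling [p] so that [psi_1 p(theta_1) = sin (pi / (2 (2 k + 1)))]
   makes the final rotation stop at the right angle.
   Unit complex numbers [c + i s] replace the angles throughout. *)

(** * Adjoints and query circuits *)

Section Adjoint.
Variable R : realType.
Local Notation C := R[i].

Lemma adjmxE m n (A : 'M[C]_(m, n)) i j : adjmx A i j = (A j i)^*.
Proof. by rewrite !mxE. Qed.

Lemma adjmxM m n p (A : 'M[C]_(m, n)) (B : 'M[C]_(n, p)) :
  adjmx (A *m B) = adjmx B *m adjmx A.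
Proof. by rewrite /adjmx map_mxM trmx_mul. Qed.

Lemma adjmxK m n (A : 'M[C]_(m, n)) : adjmx (adjmx A) = A.
Proof. by apply/matrixP=> i j; rewrite !adjmxE conjcK. Qed.

Lemma adjmx1 n : adjmx (1%:M : 'M[C]_n) = 1%:M.
Proof. by rewrite /adjmx map_mx1 trmx1. Qed.

Lemma adjmx_tens m n p q (A : 'M[C]_(m, n)) (B : 'M[C]_(p, q)) :
  adjmx (A *t B) = adjmx A *t adjmx B.
Proof. by rewrite /adjmx map_mxT trmx_tens. Qed.

Lemma unitary1 n : unitary (1%:M : 'M[C]_n).
Proof. by rewrite /unitary adjmx1 !mulmx1. Qed.

Lemma unitaryM n (A B : 'M[C]_n) : unitary A -> unitary B -> unitary (A *m B).
Proof.
move=> [A1 A2] [B1 B2]; rewrite /unitary adjmxM; split.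
  by rewrite mulmxA -(mulmxA A) B1 mulmx1.
by rewrite mulmxA -(mulmxA (adjmx B)) A2 mulmx1.
Qed.

Lemma unitary_adj n (A : 'M[C]_n) : unitary A -> unitary (adjmx A).
Proof. by move=> [A1 A2]; rewrite /unitary adjmxK. Qed.

Lemma tensmx11 m n : (1%:M : 'M[C]_m) *t (1%:M : 'M[C]_n) = 1%:M.
Proof.
apply/matrixP=> i j; case: (mxtens_indexP i) => i1 i2; case: (mxtens_indexP j) => j1 j2.
rewrite tensmxE !mxE (can_eq (@mxtens_indexK _ _)) xpair_eqE.
by do 2!case: eqP => _; rewrite ?mulr0 ?mul0r ?mulr1.
Qed.

Lemma unitary_tens m n (A : 'M[C]_m) (B : 'M[C]_n) :
  unitary A -> unitary B -> unitary (A *t B).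
Proof.
by move=> [A1 A2] [B1 B2]; rewrite /unitary adjmx_tens !tensmx_mul A1 A2 B1 B2 tensmx11.
Qed.

Lemma hermitian_unitary n (A : 'M[C]_n) :
  adjmx A = A -> A *m A = 1%:M -> unitary A.
Proof. by move=> hA AA; rewrite /unitary hA. Qed.

Lemma cquery_adj N (U : 'M[C]_N) b anc :
  adjmx (cquery U b anc) = cquery U (~~ b) anc.
Proof.
rewrite /cquery adjmx_tens adjmx1; congr (_ *t _).
rewrite /adjmx map_block_mx tr_block_mx map_mx1 trmx1 !raddf0.
by congr block_mx; case: b => //=; rewrite -[LHS]/(adjmx (adjmx U)) adjmxK.
Qed.

End Adjoint.

(** * Circuit families with a query count *)

Section Implementation.
Variables (R : realType) (N anc : nat).
Local Notation C := R[i].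
Local Notation D := ((N + N) * anc)%N.

Fixpoint query_prod (g : nat -> 'M[C]_D) (dq : nat -> bool) (U : 'M[C]_N) (q : nat) :=
  if q is q'.+1 then g q *m (cquery U (dq q') anc *m query_prod g dq U q') else g 0.

(** The gates and query directions are chosen before [U], so one circuit serves every oracle.
    Indexing by [nat] lets circuits be concatenated without casts. *)
Definition implementable (q : nat) (F : 'M[C]_N -> 'M[C]_D) : Prop :=
  exists (g : nat -> 'M[C]_D) (dq : nat -> bool),
    (forall k, unitary (g k)) /\ forall U, F U = query_prod g dq U q.

Lemma implementable_gate (G : 'M[C]_D) : unitary G -> implementable 0 (fun=> G).
Proof. by move=> uG; exists (fun=> G), (fun=> false). Qed.

Lemma implementable_query b : implementable 1 (fun U => cquery U b anc).
Proof.
exists (fun=> 1%:M), (fun=> b); split=> [_|U /=]; first exact: unitary1.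
by rewrite mulmx1 mul1mx.
Qed.

(** Query counts add exactly because the last gate of the first circuit and the first gate of the
    second are fused into the single gate at index [q1]. *)
Lemma implementable_mul q1 q2 F1 F2 :
  implementable q1 F1 -> implementable q2 F2 ->
  implementable (q1 + q2) (fun U => F2 U *m F1 U).
Proof.
move=> [g1 [d1 [u1 e1]]] [g2 [d2 [u2 e2]]].
pose g k := if (k < q1)%N then g1 k else
  if k == q1 then g2 0 *m g1 q1 else g2 (k - q1)%N.
pose d k := if (k < q1)%N then d1 k else d2 (k - q1)%N.
exists g, d; split=> [k|U].
  by rewrite /g; case: ifP => // _; case: ifP => // _; apply: unitaryM.
rewrite e1 e2.
have lt_g k : (k < q1)%N -> query_prod g d U k = query_prod g1 d1 U k.
  elim: k => [|k IH] ltk /=; first by rewrite /g ltk.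
  by have ltk' := ltnW ltk; rewrite (IH ltk') [g _]/g [d _]/d ltk ltk'.
elim: q2 {e2} => [|q IH] /=.
  rewrite addn0; case: q1 @g @d lt_g {e1} => [|q1] g d lt_g /=.
    by rewrite /g /=.
  by rewrite lt_g // /g ltnn eqxx /d leqnn -!mulmxA.
rewrite addnS /= -IH /g -addnS ltnNge leq_addr /=.
rewrite -[X in _ == X]addn0 eqn_add2l /= addKn /d ltnNge leq_addr /= addKn.
by rewrite !mulmxA.
Qed.

Lemma implementable_gate_mul q F (G : 'M[C]_D) :
  unitary G -> implementable q F -> implementable q (fun U => G *m F U).
Proof.
by move=> uG iF; have := implementable_mul iF (implementable_gate uG); rewrite addn0.
Qed.

Lemma implementable_query_mul q F b :
  implementable q F -> implementable q.+1 (fun U => cquery U b anc *m F U).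
Proof.
by move=> iF; have := implementable_mul iF (implementable_query b); rewrite addn1.
Qed.

(** Run the circuit backwards: gates become their adjoints, and the adjoint of a query is again one
    query, in the opposite direction. *)
Lemma implementable_adj q F :
  implementable q F -> implementable q (fun U => adjmx (F U)).
Proof.
move=> [g [d [ug eF]]].
suff [g' [d' [ug' e']]] : implementable q (fun U => adjmx (query_prod g d U q)).
  by exists g', d'; split=> // U; rewrite eF e'.
elim: q {eF} => [|q IH] /=; first exact/implementable_gate/unitary_adj.
have := implementable_mul (implementable_query_mul (~~ d q)
  (implementable_gate (unitary_adj (ug q.+1)))) IH.
move=> [g' [d' [ug' e']]]; exists g', d'; split=> // U.
by rewrite -e' !adjmxM cquery_adj mulmxA.
Qed.

Lemma implementable_qalg q F (out : 'I_D -> 'I_N) : implementable q F ->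
  exists A : qalg R N, [/\ qalg_unitary A, nq A = q &
    forall U x, success_prob A U x =
      \sum_(o | out o == x) `|(F U *m ket0 R D) o ord0| ^+ 2].
Proof.
move=> [g [d [ug eF]]].
exists (@QAlg R N anc q (fun k => g k) d out).
split=> [k||U x]; [exact: ug | by [] |].
rewrite /success_prob /final_state /=; apply: eq_bigr => o _.
congr (`| (_ : 'cV_D) o ord0 | ^+ 2); rewrite eF.
suff qE k : (k <= q)%N -> qstate (QAlg (fun k : 'I_q.+1 => g k) d out) U k =
  query_prod g d U k *m ket0 R D by rewrite qE.
elim: k => [|k IH] lek //=.
by rewrite IH ?(ltnW lek) // inordK // !mulmxA.
Qed.

End Implementation.

(** * Grover iteration *)

Section Grover.
Variables (R : realType) (n : nat).
Local Notation C := R[i].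

Definition grover (Psi : 'cV[C]_n) (P : 'M[C]_n) : 'M[C]_n :=
  (2 *: (Psi *m adjmx Psi) - 1%:M) *m (1%:M - 2 *: P).

(** The span of [g = P Psi] and [Psi - g] is invariant: the first reflection negates [al], and
    [t / 2] is the inner product of the result with [Psi], about which the second one reflects. *)
Lemma grover_comb (Psi g : 'cV[C]_n) (P : 'M[C]_n) (s2 al be : C) :
  adjmx Psi *m Psi = 1%:M -> adjmx Psi *m g = s2%:M ->
  P *m Psi = g -> P *m g = g ->
  let t := 2 * (be * (1 - s2) - al * s2) in
  grover Psi P *m (al *: g + be *: (Psi - g)) =
    (t + al) *: g + (t - be) *: (Psi - g).
Proof.
move=> nPsi Pg PPsi Pgg t; rewrite /grover -mulmxA.
have -> : (1%:M - 2 *: P) *m (al *: g + be *: (Psi - g)) =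
          (- al) *: g + be *: (Psi - g).
  rewrite mulmxBl mul1mx -scalemxAl mulmxDr -!scalemxAr mulmxBr PPsi Pgg subrr.
  rewrite scaler0 addr0 addrAC scalerA; congr (_ + _).
  by rewrite -scalerBl; congr (_ *: _); ring.
rewrite mulmxBl mul1mx -scalemxAl -mulmxA.
have -> : adjmx Psi *m (- al *: g + be *: (Psi - g)) = (t / 2)%:M.
  rewrite mulmxDr -!scalemxAr mulmxBr nPsi Pg -raddfB /= !scale_scalar_mx -raddfD /=.
  congr (_%:M); rewrite /t.
  by field.
rewrite mul_mx_scalar scalerA mulrCA divff ?pnatr_eq0 // mulr1.
rewrite -{1}[Psi](subrK g) scalerDr !scalerDl !scaleNr opprD opprK.
by rewrite [t *: _ + _]addrC addrACA.
Qed.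

(* [be c + i al s = (c + i s)^(2 k + 1)]: the iterate makes the angle
   [(2 k + 1) theta] with the bad axis, written without dividing by [c] or [s]. *)
Lemma grover_power (Psi g : 'cV[C]_n) (P : 'M[C]_n) (s c : R) k :
  adjmx Psi *m Psi = 1%:M -> adjmx Psi *m g = ((s ^+ 2)%:C)%:M ->
  P *m Psi = g -> P *m g = g -> c ^+ 2 + s ^+ 2 = 1 ->
  exists al be : R,
    iter k (mulmx (grover Psi P)) Psi = al%:C *: g + be%:C *: (Psi - g) /\
    (be * c) +i* (al * s) = (c +i* s) ^+ (k.*2.+1).
Proof.
move=> nPsi Pg PPsi Pgg cs.
have c2 : c ^+ 2 = 1 - s ^+ 2 by rewrite -cs addrK.
elim: k => [|k [al [be [IH1 IH2]]]].
  exists 1, 1; split=> /=; first by rewrite !scale1r subrKC.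
  by rewrite !mul1r expr1.
pose t := 2 * (be * (1 - s ^+ 2) - al * s ^+ 2).
exists (t + al), (t - be); split.
  rewrite iterS IH1 (grover_comb _ _ nPsi Pg PPsi Pgg).
  have -> : 2 * (be%:C * (1 - (s ^+ 2)%:C) - al%:C * (s ^+ 2)%:C) = t%:C.
    rewrite /t; move: (s ^+ 2) => x; apply/eqP; rewrite eq_complex /=.
    by apply/andP; split; apply/eqP; ring.
  by rewrite -rmorphD -rmorphB.
(* One iteration is multiplication by [(c + i s)^2], once [1 - s ^+ 2] is read as [c ^+ 2]. *)
rewrite doubleS exprSr exprSr -IH2; apply/eqP; rewrite eq_complex /=.
by apply/andP; split; apply/eqP; rewrite /t -c2; move: c2; clear => c2; ring: c2.
Qed.

End Grover.

(** * Gates on control x system x ancilla x counter *)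

Lemma big_mxtens (V : nmodType) n p (F : 'I_(n * p) -> V) :
  \sum_o F o = \sum_i \sum_j F (mxtens_index (i, j)).
Proof.
rewrite (pair_bigA _ (fun i j => F (mxtens_index (i, j)))) /=.
rewrite (reindex (@mxtens_index n p)) /=; last first.
  by exists (@mxtens_unindex _ _) => k _; rewrite ?mxtens_indexK ?mxtens_unindexK.
by apply: eq_bigr => -[].
Qed.

Section Gates.
Variable R : realType.
Local Notation C := R[i].

Definition sign_gate n (q : pred 'I_n) : 'M[C]_n :=
  diag_mx (\row_i (-1) ^+ q i).

Lemma sign_gateE n (q : pred 'I_n) (v : 'cV[C]_n) i :
  (sign_gate q *m v) i ord0 = (-1) ^+ q i * v i ord0.
Proof. by rewrite /sign_gate mul_diag_mx !mxE. Qed.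

Lemma sign_gate_adj n (q : pred 'I_n) : adjmx (sign_gate q) = sign_gate q.
Proof.
rewrite /adjmx map_diag_mx tr_diag_mx; congr diag_mx; apply/rowP=> i; rewrite !mxE.
by case: (q i); rewrite ?expr1 ?expr0 ?rmorphN ?rmorph1.
Qed.

Lemma sign_gate_unitary n (q : pred 'I_n) : unitary (sign_gate q).
Proof.
apply: hermitian_unitary; first exact: sign_gate_adj.
apply/matrixP=> i j; rewrite /sign_gate mul_diag_mx !mxE mulrnAr.
by rewrite -signr_addb addbb.
Qed.

Definition involution_gate n (s : 'I_n -> 'I_n) : 'M[C]_n :=
  \matrix_(i, j) (s i == j)%:R.

Lemma involution_gateE n (s : 'I_n -> 'I_n) (v : 'cV[C]_n) i :
  (involution_gate s *m v) i ord0 = v (s i) ord0.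
Proof.
rewrite !mxE (bigD1 (s i)) //= mxE eqxx mul1r big1 ?addr0 // => j.
by rewrite mxE eq_sym => /negPf->; rewrite mul0r.
Qed.

Lemma involution_gate_unitary n (s : 'I_n -> 'I_n) :
  involutive s -> unitary (involution_gate s).
Proof.
move=> sK; apply: hermitian_unitary.
  apply/matrixP=> i j; rewrite adjmxE !mxE conjc_nat.
  by rewrite (inv_eq sK) eq_sym.
apply/matrixP=> i j; have := involution_gateE s (col j (involution_gate s)) i.
by rewrite !mxE sK => <-; apply: eq_bigr => k _; rewrite !mxE.
Qed.

(* The reflection exchanging the orthonormal vectors [delta_f0] and [v]. *)
Definition exchange_gate L (f0 : 'I_L) (v : 'I_L -> R) : 'M[C]_L :=
  \matrix_(i, j) ((i == j)%:R -
    ((i == f0)%:R - v i) * ((j == f0)%:R - v j))%:C.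

Lemma exchange_gate_col L (f0 : 'I_L) v i :
  v f0 = 0 -> exchange_gate f0 v i f0 = (v i)%:C.
Proof.
by move=> v0; rewrite mxE eqxx v0 subr0 mulr1; congr (_%:C); rewrite opprB addrC subrK.
Qed.

Lemma exchange_gate_sym L (f0 : 'I_L) v i j :
  exchange_gate f0 v i j = exchange_gate f0 v j i.
Proof. by rewrite !mxE eq_sym mulrC. Qed.

(** The gate is the Householder reflection [1 - y y^T] with [y = delta_f0 - v]; orthogonality of the
    two unit vectors gives [|y|^2 = 2], which makes its square the identity. *)
Lemma exchange_gate_unitary L (f0 : 'I_L) v :
  v f0 = 0 -> \sum_f v f ^+ 2 = 1 -> unitary (exchange_gate f0 v).
Proof.
move=> v0 v1; apply: hermitian_unitary.
  by apply/matrixP=> i j; rewrite adjmxE exchange_gate_sym !mxE conjc_real.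
pose y i := (i == f0)%:R - v i.
have y2 : \sum_i y i ^+ 2 = 2.
  rewrite (eq_bigr (fun i => (i == f0)%:R + v i ^+ 2)); last first.
    move=> i _; rewrite /y; case: eqP => [->|_]; rewrite ?v0 /=; first by ring.
    by rewrite sub0r sqrrN add0r.
  rewrite big_split /= v1 (bigD1 f0) //= eqxx big1 ?addr0 //.
  by move=> i /negPf->.
apply/matrixP=> i j; rewrite !mxE.
under eq_bigr => k _ do rewrite !mxE -rmorphM /=.
rewrite -rmorph_sum /= -[RHS](rmorph_nat (real_complex R)); congr (_%:C).
rewrite -/(y i) -/(y j).
under eq_bigr => k _ do rewrite -/(y k).
transitivity (\sum_k ((i == k)%:R * (k == j)%:R - y i * ((k == j)%:R * y k)
    - y j * ((i == k)%:R * y k)  + y i * y j * y k ^+ 2)).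
  by apply: eq_bigr => k _; ring.
rewrite big_split /= !sumrB -!mulr_sumr y2.
rewrite (bigD1 i) //= eqxx mul1r big1 ?addr0; last first.
  by move=> k /negPf; rewrite eq_sym => ->; rewrite mul0r.
rewrite (bigD1 j) //= eqxx mul1r big1 ?addr0; last first.
  by move=> k /negPf ->; rewrite mul0r.
rewrite (bigD1 i) //= eqxx mul1r big1 ?addr0; last first.
  by move=> k /negPf; rewrite eq_sym => ->; rewrite mul0r.
by ring.
Qed.

(** A vector of the product space as a family of slices, so that a gate on the first factor acts
    slice by slice. *)
Definition tens_col n p (h : 'I_p -> 'cV[C]_n) : 'cV[C]_(n * p) :=
  \col_o h (mxtens_unindex o).2 (mxtens_unindex o).1 ord0.

Lemma tens_colE n p (h : 'I_p -> 'cV[C]_n) i j :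
  tens_col h (mxtens_index (i, j)) ord0 = h j i ord0.
Proof. by rewrite mxE mxtens_indexK. Qed.

Lemma eq_tens_col n p (h k : 'I_p -> 'cV[C]_n) : h =1 k -> tens_col h = tens_col k.
Proof. by move=> hk; apply/colP=> o; rewrite !mxE hk. Qed.

Lemma tensmx_tens_col n p (M : 'M[C]_n) (K : 'M[C]_p) (h : 'I_p -> 'cV[C]_n) :
  (M *t K) *m tens_col h = tens_col (fun j => \sum_j' K j j' *: (M *m h j')).
Proof.
apply/colP=> o; case: (mxtens_indexP o) => i j.
rewrite tens_colE summxE mxE.
rewrite big_mxtens /=.
rewrite exchange_big /=; apply: eq_bigr => j' _; rewrite !mxE big_distrr /=.
by apply: eq_bigr => i' _; rewrite tensmxE tens_colE mulrA [K _ _ * _]mulrC.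
Qed.

Lemma tensmx1_tens_col n p (M : 'M[C]_n) (h : 'I_p -> 'cV[C]_n) :
  (M *t (1%:M : 'M[C]_p)) *m tens_col h = tens_col (fun j => M *m h j).
Proof.
rewrite tensmx_tens_col; apply: eq_tens_col => j.
rewrite (bigD1 j) //= mxE eqxx scale1r big1 ?addr0 // => k.
by rewrite mxE eq_sym => /negPf ->; rewrite scale0r.
Qed.

End Gates.

Section Workspace.
Variables (R : realType) (N L : nat).
Local Notation C := R[i].
Local Notation D := ((N + N) * (N * L))%N.

Definition ws_index (c : bool) (b a : 'I_N) (f : 'I_L) : 'I_D :=
  mxtens_index (if c then rshift N b else lshift N b, mxtens_index (a, f)).

Definition ws_ctrl (o : 'I_D) : bool :=
  if split (mxtens_unindex o).1 is inr _ then true else false.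
Definition ws_sys (o : 'I_D) : 'I_N :=
  match split (mxtens_unindex o).1 with inl b => b | inr b => b end.
Definition ws_anc (o : 'I_D) : 'I_N := (mxtens_unindex (mxtens_unindex o).2).1.
Definition ws_cnt (o : 'I_D) : 'I_L := (mxtens_unindex (mxtens_unindex o).2).2.

Lemma ws_indexK c b a f : let o := ws_index c b a f in
  [/\ ws_ctrl o = c, ws_sys o = b, ws_anc o = a & ws_cnt o = f].
Proof.
rewrite /= /ws_ctrl /ws_sys /ws_anc /ws_cnt /ws_index !mxtens_indexK /=.
by case: c; [rewrite (unsplitK (inr b)) | rewrite (unsplitK (inl b))].
Qed.

Lemma ws_unindexK o : ws_index (ws_ctrl o) (ws_sys o) (ws_anc o) (ws_cnt o) = o.
Proof.
case: (mxtens_indexP o) => i j; case: (mxtens_indexP j) => a f.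
rewrite /ws_ctrl /ws_sys /ws_anc /ws_cnt !mxtens_indexK /= /ws_index.
by case: (split_ordP i) => b ->.
Qed.

Lemma ws_index_inj c b a f c' b' a' f' :
  (ws_index c b a f == ws_index c' b' a' f') = [&& c == c', b == b', a == a' & f == f'].
Proof.
apply/eqP/and4P => [eo|[/eqP-> /eqP-> /eqP-> /eqP->] //].
have [] := ws_indexK c b a f; rewrite /= eo.
by have [-> -> -> ->] := ws_indexK c' b' a' f' => -> -> -> ->.
Qed.

(* The control qubit is set; [g a f] is the (unnormalised) system register
   when the ancilla holds [a] and the counter [f]. *)
Definition ws_state (g : 'I_N -> 'I_L -> 'cV[C]_N) : 'cV[C]_D :=
  \col_o (if ws_ctrl o then g (ws_anc o) (ws_cnt o) (ws_sys o) ord0 else 0).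

Lemma ws_stateE (g : 'I_N -> 'I_L -> 'cV[C]_N) c b a f :
  ws_state g (ws_index c b a f) ord0 = if c then g a f b ord0 else 0.
Proof. by rewrite mxE; have [-> -> -> ->] := ws_indexK c b a f. Qed.

Lemma ws_stateP (v : 'cV[C]_D) (g : 'I_N -> 'I_L -> 'cV[C]_N) :
  (forall c b a f, v (ws_index c b a f) ord0 = if c then g a f b ord0 else 0) ->
  v = ws_state g.
Proof. by move=> vE; apply/colP=> o; rewrite -(ws_unindexK o) vE ws_stateE. Qed.

Lemma eq_ws_state g h : (forall a f, g a f = h a f) -> ws_state g = ws_state h.
Proof. by move=> gh; apply/colP=> o; rewrite !mxE gh. Qed.

Lemma ws_state_tens_col g : ws_state g =
  tens_col (fun j => col_mx 0 (g (mxtens_unindex j).1 (mxtens_unindex j).2)).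
Proof.
symmetry; apply: ws_stateP => c b a f; rewrite /ws_index tens_colE mxtens_indexK /=.
by case: c; [rewrite col_mxEd | rewrite col_mxEu mxE].
Qed.

Lemma cquery_ws_state (U : 'M[C]_N) b g : cquery U b (N * L) *m ws_state g =
  ws_state (fun a f => (if b then adjmx U else U) *m g a f).
Proof.
rewrite !ws_state_tens_col tensmx1_tens_col; apply: eq_tens_col => j.
by rewrite mul_block_col !mul0mx !mulmx0 addr0 add0r.
Qed.

Definition counter_gate (K : 'M[C]_L) : 'M[C]_D := 1%:M *t (1%:M *t K).

Lemma counter_gate_unitary K : unitary K -> unitary (counter_gate K).
Proof. by move=> uK; do 2!(apply: unitary_tens; first exact: unitary1). Qed.

Lemma counter_gate_ws_state K g : counter_gate K *m ws_state g =
  ws_state (fun a f => \sum_f' K f f' *: g a f').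
Proof.
rewrite !ws_state_tens_col; set h := fun j => col_mx 0 (g _ _).
have hE a f : h (mxtens_index (a, f)) = col_mx 0 (g a f) by rewrite /h mxtens_indexK.
move: h hE => h hE; rewrite tensmx_tens_col; apply: eq_tens_col => j.
case: (mxtens_indexP j) => a f; rewrite big_mxtens mxtens_indexK.
rewrite (bigD1 a) //= [X in _ + X]big1 ?addr0; last first.
  move=> a' /negPf na; apply: big1 => f' _.
  by rewrite tensmxE mxE eq_sym na mul0r scale0r.
under eq_bigr => f' _ do
  rewrite tensmxE mxE eqxx mul1r mul1mx hE scale_col_mx scaler0.
apply/colP=> i; rewrite summxE; case: (split_ordP i) => k ->.
  by rewrite col_mxEu mxE big1 // => f' _; rewrite col_mxEu mxE.
by rewrite col_mxEd summxE; apply: eq_bigr => f' _; rewrite col_mxEd.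
Qed.

(** Moves the label loaded by [U] from the system register to the ancilla, leaving the system in
    [|0>]. *)
Definition swap_gate : 'M[C]_D :=
  involution_gate R (fun o => ws_index (ws_ctrl o) (ws_anc o) (ws_sys o) (ws_cnt o)).

Lemma swap_gate_unitary : unitary swap_gate.
Proof.
apply: involution_gate_unitary => o.
by have [-> -> -> ->] := ws_indexK (ws_ctrl o) (ws_anc o) (ws_sys o) (ws_cnt o);
  rewrite ws_unindexK.
Qed.

Lemma swap_gate_ws_state (g : 'I_N -> 'I_L -> 'cV[C]_N) :
  swap_gate *m ws_state g = ws_state (fun a f => \col_b g b f a ord0).
Proof.
apply: ws_stateP => c b a f; rewrite involution_gateE.
by have [-> -> -> ->] := ws_indexK c b a f; rewrite ws_stateE mxE.
Qed.

(** Sets the control qubit once at the start, so that every later query really applies [U] or its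
    adjoint. *)
Definition flip_gate : 'M[C]_D :=
  involution_gate R (fun o => ws_index (~~ ws_ctrl o) (ws_sys o) (ws_anc o) (ws_cnt o)).

Lemma flip_gate_unitary : unitary flip_gate.
Proof.
apply: involution_gate_unitary => o.
by have [-> -> -> ->] := ws_indexK (~~ ws_ctrl o) (ws_sys o) (ws_anc o) (ws_cnt o);
  rewrite negbK ws_unindexK.
Qed.

Lemma flip_gate_ket0 (z : 'I_N) (f0 : 'I_L) : nat_of_ord z = 0 -> nat_of_ord f0 = 0 ->
  flip_gate *m ket0 R D = delta_mx (ws_index true z z f0) ord0.
Proof.
move=> z0 f00; have -> : ket0 R D = delta_mx (ws_index false z z f0) ord0.
  apply/colP=> j; rewrite !mxE eqxx andbT -val_eqE /= z0 f00 /=.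
  by rewrite mul0n add0n.
apply/colP=> o; rewrite involution_gateE !mxE eqxx !andbT.
rewrite -{5}(ws_unindexK o) !ws_index_inj.
by case: (ws_ctrl o).
Qed.

Definition ctrl_sign_gate (q : 'I_N -> 'I_N -> 'I_L -> bool) : 'M[C]_D :=
  sign_gate R (fun o => q (ws_sys o) (ws_anc o) (ws_cnt o)).

Lemma ctrl_sign_gate_ws_state q g : ctrl_sign_gate q *m ws_state g =
  ws_state (fun a f => sign_gate R (fun b => q b a f) *m g a f).
Proof.
apply: ws_stateP => c b a f; rewrite sign_gateE ws_stateE.
have [_ -> -> ->] := ws_indexK c b a f.
by case: c; rewrite ?mulr0 // sign_gateE.
Qed.

End Workspace.

(** * The Fejer filter *)

Section Kernel.
Variable R : realType.
Local Notation C := R[i].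

Lemma ReD (x y : C) : complex.Re (x + y) = complex.Re x + complex.Re y.
Proof. by case: x y => [? ?] [? ?]. Qed.

Lemma Re_realM (x : R) (y : C) : complex.Re (x%:C * y) = x * complex.Re y.
Proof. by case: y => [a b] /=; rewrite mul0r subr0. Qed.

Lemma Re_sum (I : finType) (F : I -> C) :
  complex.Re (\sum_i F i) = \sum_i complex.Re (F i).
Proof. by elim/big_rec2: _ => // i x y _ <-; rewrite ReD. Qed.

Lemma ReM_Re (x y : C) :
  complex.Re x * complex.Re y = (complex.Re (x * y) + complex.Re (x^* * y)) / 2.
Proof. by case: x y => [a b] [c d] /=; field. Qed.

Lemma mulcJ_unit (z : C) : `|z| = 1 -> z * z^* = 1.
Proof. by move=> z1; rewrite -sqr_normc z1 expr1n. Qed.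

(** The Dirichlet kernel, normalised to be 1 at [z = 1]. *)
Definition mean_pow (K : nat) (z : C) : C := K%:R^-1 * \sum_(k < K) z ^+ k.

Definition fejer (K : nat) (z : C) : C := mean_pow K z * mean_pow K z^*.

Lemma mean_pow_conj K z : mean_pow K z^* = (mean_pow K z)^*.
Proof.
rewrite /mean_pow rmorphM rmorph_sum /= conjc_inv conjc_nat; congr (_ * _).
by apply: eq_bigr => k _; rewrite rmorphXn.
Qed.

Lemma fejerE K z : fejer K z = `|mean_pow K z| ^+ 2.
Proof. by rewrite /fejer mean_pow_conj sqr_normc. Qed.

Lemma fejer_ge0 K z : 0 <= fejer K z.
Proof. by rewrite fejerE exprn_ge0. Qed.

Lemma fejer1 K : (0 < K)%N -> fejer K 1 = 1.
Proof.
move=> K0; rewrite fejerE /mean_pow.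
under eq_bigr => k _ do rewrite expr1n.
by rewrite sumr_const card_ord mulVf ?pnatr_eq0 -?lt0n // normr1 expr1n.
Qed.

(** Summing the geometric series, [|1 - z|] times the sum is [|1 - z^K| <= 2], while
    [K |1 - z| >= 4]. *)
Lemma mean_pow_le K (z : C) (d : R) : `|z| = 1 -> 0 < d -> d%:C <= `|1 - z| ->
  4 <= d * K%:R -> `|mean_pow K z| <= 2^-1.
Proof.
move=> z1 d0 dz dK.
have K0 : (0 < K)%N.
  by case: (posnP K) dK => // ->; rewrite mulr0 => /(lt_le_trans _) -/(_ 0); rewrite ltxx; apply.
have nz0 : 0 < `|1 - z| by apply: lt_le_trans dz; rewrite (ltcR 0).
have n4 : 4 <= `|1 - z| * K%:R.
  apply: le_trans (ler_wpM2r (ler0n _ _) dz).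
  rewrite -(rmorph_nat (real_complex R) K) -rmorphM.
  by rewrite -(rmorph_nat (real_complex R) 4) lecR.
rewrite /mean_pow normrM normfV normr_nat ler_pdivrMl ?ltr0n //.
rewrite -(ler_pM2l nz0) {1}distrC -normrM -subrX1.
apply: le_trans (ler_normB _ _) _; rewrite normr1 normrX z1 expr1n mulrA.
rewrite ler_pdivlMr ?ltr0n //.
by have -> : (1 + 1) * 2 = 4 :> C by ring.
Qed.

Lemma fejer_le K (z : C) (d : R) : `|z| = 1 -> 0 < d -> d%:C <= `|1 - z| ->
  4 <= d * K%:R -> fejer K z <= 4^-1.
Proof.
move=> z1 d0 dz dK; rewrite fejerE.
have -> : 4^-1 = 2^-1 ^+ 2 :> C by rewrite expr2 -invfM -natrM.
by rewrite lerXn2r ?nnegrE ?invr_ge0 ?ler0n //; apply: mean_pow_le dz dK.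
Qed.

(** A counter picks one monomial from each of the [r] kernels in the expansion of [fejer K z ^+ r]:
    a power of [z] and a power of its conjugate. *)
Definition counters K r := {ffun 'I_r -> 'I_K * 'I_K}.

Definition counter_up K r (f : counters K r) : nat := \sum_i (f i).1.
Definition counter_down K r (f : counters K r) : nat := \sum_i (f i).2.
(** This is [|up - down|], since one of the two truncated differences vanishes. It will be the
    number of Grover iterations run in the branch [f]. *)
Definition counter_dist K r (f : counters K r) : nat :=
  (counter_up f - counter_down f + (counter_down f - counter_up f))%N.

Lemma counter_dist_le K r (f : counters K r) : (counter_dist f <= r * K)%N.
Proof.
have le1 : (counter_up f <= r * K)%N.
  rewrite -[X in (X * _)%N]card_ord -sum_nat_const; apply: leq_sum => i _.
  exact: ltnW.
have le2 : (counter_down f <= r * K)%N.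
  rewrite -[X in (X * _)%N]card_ord -sum_nat_const; apply: leq_sum => i _.
  exact: ltnW.
by rewrite /counter_dist; lia.
Qed.

Lemma fejer_expand K r (z : C) : (0 < K)%N ->
  \sum_(f : counters K r) z ^+ counter_up f * z^* ^+ counter_down f =
  (K ^ r)%:R ^+ 2 * fejer K z ^+ r.
Proof.
move=> K0; transitivity (\prod_(i < r) \sum_(p : 'I_K * 'I_K) z ^+ p.1 * z^* ^+ p.2).
  rewrite bigA_distr_bigA /=; apply: eq_bigr => f _.
  by rewrite big_split /= !prodrXr.
rewrite prodr_const card_ord natrX exprAC -exprMn; congr (_ ^+ _).
rewrite /fejer /mean_pow [X in _ = _ * X]mulrACA -invfM -expr2 mulVKf; last first.
  by rewrite expf_neq0 // pnatr_eq0 -lt0n.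
rewrite mulr_suml -(pair_bigA _ (fun i j : 'I_K => z ^+ i * z^* ^+ j)) /=.
by apply: eq_bigr => i _; rewrite mulr_sumr.
Qed.

(** Cancelling [z] against its conjugate leaves a power of one or the other, and both have the same
    real part. *)
Lemma Re_counter_dist K r (f : counters K r) (z : C) : `|z| = 1 ->
  complex.Re (z ^+ counter_dist f) =
  complex.Re (z ^+ counter_up f * z^* ^+ counter_down f).
Proof.
move=> z1; have zz := mulcJ_unit z1; rewrite /counter_dist.
case: (leqP (counter_down f) (counter_up f)) => h.
  rewrite (eqP h) addn0 -{2}(subnK h) exprD -mulrA -exprMn zz expr1n mulr1 //.
rewrite (eqP (ltnW h)) add0n -{2}(subnK (ltnW h)) addnC exprD mulrA -exprMn zz.
by rewrite expr1n mul1r -rmorphXn; case: (z ^+ _).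
Qed.

(** Grover overlaps supply only real parts of powers of [z]. Weighting them by the real parts for
    [z1] yields, by the product-to-sum formula, the average of two Fejer powers, one peaked at
    [z = z1] and one at its conjugate. *)
Definition peak_filter K r (z1 z : C) : R :=
  \sum_(f : counters K r)
    complex.Re (z1 ^+ counter_dist f) * complex.Re (z ^+ counter_dist f)
    / (K ^ r)%:R ^+ 2.

Lemma peak_filterE K r (z1 z : C) : (0 < K)%N -> `|z1| = 1 -> `|z| = 1 ->
  peak_filter K r z1 z =
  (complex.Re (fejer K (z1 * z) ^+ r) + complex.Re (fejer K (z1^* * z) ^+ r)) / 2.
Proof.
move=> K0 nz1 nz.
have eqC w : fejer K w ^+ r = (((K ^ r)%:R ^+ 2)^-1 : R)%:C *
    \sum_(f : counters K r) w ^+ counter_up f * w^* ^+ counter_down f.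
  rewrite fejer_expand // mulrA fmorphV rmorphXn rmorph_nat mulVf ?mul1r //.
  by rewrite expf_neq0 // pnatr_eq0 -lt0n expn_gt0 K0.
rewrite !eqC !Re_realM !Re_sum -mulrDr -big_split /= -mulrA mulr_suml mulr_sumr.
apply: eq_bigr => f _; rewrite [RHS]mulrC; congr (_ / _).
rewrite !Re_counter_dist // ReM_Re; congr (_ / _); congr (_ + _); congr complex.Re.
  by rewrite rmorphM !exprMn mulrACA.
by rewrite !rmorphM !rmorphXn /= !exprMn mulrACA.
Qed.

Lemma Re_fejerX_ge0 K r z : 0 <= complex.Re (fejer K z ^+ r).
Proof. by have := exprn_ge0 r (fejer_ge0 K z); rewrite lecE => /andP[]. Qed.

Lemma peak_filter_ge0 K r (z1 z : C) : (0 < K)%N -> `|z1| = 1 -> `|z| = 1 ->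
  0 <= peak_filter K r z1 z.
Proof.
by move=> K0 nz1 nz; rewrite peak_filterE // divr_ge0 // addr_ge0 // Re_fejerX_ge0.
Qed.

(** One of the two averaged kernels is evaluated at 1, and the other is nonnegative. *)
Lemma peak_filter_peak K r (z : C) : (0 < K)%N -> `|z| = 1 ->
  2^-1 <= peak_filter K r z z.
Proof.
move=> K0 nz; rewrite peak_filterE // [z^* * z]mulrC mulcJ_unit // fejer1 // expr1n /=.
by have := Re_fejerX_ge0 K r (z * z); lra.
Qed.

Lemma peak_filter_off K r (z1 z : C) (d : R) : `|z1| = 1 -> `|z| = 1 ->
  0 < d -> 4 <= d * K%:R -> d%:C <= `|1 - z1 * z| -> d%:C <= `|1 - z1^* * z| ->
  peak_filter K r z1 z <= 4^-1 ^+ r.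
Proof.
move=> nz1 nz d0 dK g1 g2.
have K0 : (0 < K)%N.
  by case: (posnP K) dK => // ->; rewrite mulr0 => /(lt_le_trans _) -/(_ 0); rewrite ltxx; apply.
have bnd w : `|w| = 1 -> d%:C <= `|1 - w| ->
    complex.Re (fejer K w ^+ r) <= 4^-1 ^+ r.
  move=> nw gw; have := fejer_le nw d0 gw dK.
  move=> /(lerXn2r r) -/(_ (fejer_ge0 _ _)); rewrite nnegrE invr_ge0 ler0n => /(_ isT).
  have -> : 4^-1 ^+ r = (4^-1 ^+ r : R)%:C by rewrite rmorphXn fmorphV rmorph_nat.
  by rewrite lecE /= => /andP[].
rewrite peak_filterE //.
have := bnd _ _ g1; have := bnd _ _ g2.
rewrite !normrM normcJ nz1 nz mulr1 => /(_ erefl) h1 /(_ erefl) h2.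
by lra.
Qed.

Lemma normc_unit (c s : R) : c ^+ 2 + s ^+ 2 = 1 -> `|c +i* s| = 1.
Proof. by move=> cs; rewrite normc_def /= cs sqrtr1. Qed.

Lemma normc_ge (x : C) (d : R) : 0 <= d ->
  d ^+ 2 <= complex.Re x ^+ 2 + complex.Im x ^+ 2 -> d%:C <= `|x|.
Proof.
move=> d0 dx; rewrite normc_def lecR -[d](ger0_norm d0) -sqrtr_sqr.
by rewrite ler_wsqrtr.
Qed.

(** With [X] the cosine of the angle difference, the squared modulus is [(2 - 2 X)(2 + 2 X)]. The
    first factor is a squared chord, at least [d ^+ 2]; the second is at least 2 because
    [X >= 0]. *)
Lemma angle_gap_diff (c s c' s' d : R) : c ^+ 2 + s ^+ 2 = 1 -> c' ^+ 2 + s' ^+ 2 = 1 ->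
  0 <= c -> 0 <= c' -> 0 <= s' -> 0 <= d -> d <= s - s' ->
  d%:C <= `|1 - ((c +i* s) ^+ 2)^* * (c' +i* s') ^+ 2|.
Proof.
move=> cs cs' c0 c0' s0' d0 ds; apply: normc_ge => //=.
have [X XE] : {X | X = c * c' + s * s'} by eexists.
have X0 : 0 <= X by rewrite XE addr_ge0 // mulr_ge0 //; lra.
have X1 : d ^+ 2 <= 2 - 2 * X.
  apply: le_trans (_ : (c - c') ^+ 2 + (s - s') ^+ 2 <= _).
    by rewrite ler_wpDl ?sqr_ge0 // lerXn2r ?nnegrE //; lra.
  by move: cs cs'; rewrite XE; clear; nra.
apply: le_trans (_ : (2 - 2 * X) * (2 + 2 * X) <= _).
  by apply: le_trans X1 (ler_peMr (le_trans (sqr_ge0 d) X1) _); lra.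
rewrite le_eqVlt; apply/orP; left; apply/eqP; rewrite XE.
have c2 : c ^+ 2 = 1 - s ^+ 2 by rewrite -cs addrK.
have c2' : c' ^+ 2 = 1 - s' ^+ 2 by rewrite -cs' addrK.
by move: c2 c2'; clear => c2 c2'; ring: c2 c2'.
Qed.

(** Here [X] is the cosine of the angle sum and may be negative. Both factors are squared chords of
    length at least [d], and the sign of [X] decides which of them is at least 2. *)
Lemma angle_gap_sum (c s c' s' d : R) : c ^+ 2 + s ^+ 2 = 1 -> c' ^+ 2 + s' ^+ 2 = 1 ->
  0 <= c -> 0 <= c' -> 0 <= s' -> 0 <= d -> d <= s - s' ->
  d%:C <= `|1 - (c +i* s) ^+ 2 * (c' +i* s') ^+ 2|.
Proof.
move=> cs cs' c0 c0' s0' d0 ds; apply: normc_ge => //=.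
have [X XE] : {X | X = c * c' - s * s'} by eexists.
have X1 : d ^+ 2 <= 2 - 2 * X.
  apply: le_trans (_ : (c - c') ^+ 2 + (s + s') ^+ 2 <= _).
    by rewrite ler_wpDl ?sqr_ge0 // lerXn2r ?nnegrE //; lra.
  by move: cs cs'; rewrite XE; clear; nra.
have X2 : d ^+ 2 <= 2 + 2 * X.
  apply: le_trans (_ : (c + c') ^+ 2 + (s - s') ^+ 2 <= _).
    by rewrite ler_wpDl ?sqr_ge0 // lerXn2r ?nnegrE //; lra.
  by move: cs cs'; rewrite XE; clear; nra.
apply: le_trans (_ : (2 - 2 * X) * (2 + 2 * X) <= _).
  have d2 := sqr_ge0 d.
  case: (leP 0 X) => hX; first by apply: le_trans X1 (ler_peMr (le_trans d2 X1) _); lra.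
  by apply: le_trans X2 (ler_peMl (le_trans d2 X2) _); lra.
rewrite le_eqVlt; apply/orP; left; apply/eqP; rewrite XE.
have c2 : c ^+ 2 = 1 - s ^+ 2 by rewrite -cs addrK.
have c2' : c' ^+ 2 = 1 - s' ^+ 2 by rewrite -cs' addrK.
by move: c2 c2'; clear => c2 c2'; ring: c2 c2'.
Qed.

End Kernel.

(** * Amplification error *)

Lemma normB_X_le (K : numDomainType) (x y : K) m : `|x| = 1 -> `|y| = 1 ->
  `|x ^+ m - y ^+ m| <= m%:R * `|x - y|.
Proof.
move=> x1 y1; rewrite subrXX normrM mulrC; apply: ler_wpM2r => //.
apply: le_trans (ler_norm_sum _ _ _) _.
rewrite -[m in m%:R]card_ord -sumr_const; apply: ler_sum => i _.
by rewrite normrM !normrX x1 y1 !expr1n mulr1.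
Qed.

Section Amplification.
Variable R : realType.
Local Notation C := R[i].

Lemma sin_le (x : R) : 0 <= x -> sin x <= x.
Proof.
move=> x0; have [->|xn0] := eqVneq x 0; first by rewrite sin0.
have xp : 0 < x by rewrite lt0r xn0.
have [|c _] := @MVT R sin cos 0 x xp (fun y _ => is_derive_sin y).
  by apply: continuous_subspaceT; exact: continuous_sin.
rewrite sin0 !subr0 => ->.
by rewrite ler_piMl // cos_le1.
Qed.

Lemma de_Moivre (t : R) m : (cos t +i* sin t) ^+ m = cos (t *+ m) +i* sin (t *+ m).
Proof.
elim: m => [|m IH]; first by rewrite expr0 !mulr0n cos0 sin0.
rewrite exprS IH mulrS cosD sinD; apply/eqP; rewrite eq_complex /=.
by apply/andP; split; apply/eqP; ring.
Qed.

(** The angle is [pi / (2 m)]: with [m = 2 k + 1] the amplified rotation ends exactly on the good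
    axis. The bound on [s] uses [sin t <= t] and [pi / 2 <= 2]. *)
Lemma quarter_turn_root m : (0 < m)%N -> exists c s : R,
  [/\ c ^+ 2 + s ^+ 2 = 1, 0 <= c, 0 <= s, s <= 2 / m%:R & (c +i* s) ^+ m = 0 +i* 1].
Proof.
move=> m0; have mR : 0 < m%:R :> R by rewrite ltr0n.
have m1 : 1 <= m%:R :> R by rewrite ler1n.
have [p0 p2] := (pi_gt0 R, pihalf_lt2 R); have p1 := pihalf_ge1 R.
pose t : R := pi / 2 / m%:R.
have t0 : 0 <= t by rewrite divr_ge0 // ?ltW //; lra.
have tp : t <= pi / 2 by rewrite /t ler_pdivrMr // ler_peMr //; lra.
exists (cos t), (sin t); split.
- exact: cos2Dsin2.
- by apply: cos_ge0_pihalf; apply/andP; split => //; lra.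
- by apply: sin_ge0_pi; apply/andP; split => //; lra.
- by apply: le_trans (sin_le t0) _; rewrite ler_wpM2r ?invr_ge0 ?(ltW mR) // ltW.
- rewrite de_Moivre -[t *+ m]mulr_natr /t divfK ?gt_eqF //.
  by rewrite cos_pihalf sin_pihalf.
Qed.

Lemma normc_le (c s : R) : `|c +i* s| <= (`|c| + `|s|)%:C.
Proof.
have -> : c +i* s = c%:C + 'i%C * s%:C.
  by apply/eqP; rewrite eq_complex /=; apply/andP; split; apply/eqP; ring.
apply: le_trans (ler_normD _ _) _; rewrite normrM rmorphD.
have ni : `|'i%C : C| = 1 by rewrite normc_unit // expr0n add0r expr1n.
have nr (x : R) : `|x%:C| = `|x|%:C.
  by rewrite normc_def /= expr0n addr0 sqrtr_sqr.
by rewrite ni mul1r !nr.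
Qed.

Lemma normc_ge_Im (x : C) : `|complex.Im x|%:C <= `|x|.
Proof.
apply: normc_ge => //; rewrite -normrX ger0_norm ?sqr_ge0 //.
by rewrite ler_wpDl ?sqr_ge0.
Qed.

(** The [m]-th power is [m]-Lipschitz on the unit circle. *)
Lemma Im_pow_perturb (c s c' s' : R) m :
  c ^+ 2 + s ^+ 2 = 1 -> c' ^+ 2 + s' ^+ 2 = 1 ->
  `|complex.Im ((c +i* s) ^+ m) - complex.Im ((c' +i* s') ^+ m)|
    <= m%:R * (`|c - c'| + `|s - s'|).
Proof.
move=> cs cs'; rewrite -lecR rmorphM rmorph_nat.
set x := c +i* s; set y := c' +i* s'.
have -> : complex.Im (x ^+ m) - complex.Im (y ^+ m) = complex.Im (x ^+ m - y ^+ m).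
  by case: (x ^+ m) (y ^+ m) => [? ?] [? ?].
apply: le_trans (normc_ge_Im _) _.
apply: le_trans (normB_X_le _ _ _) _; try exact: normc_unit.
by apply: ler_wpM2l => //; apply: le_trans (normc_le _ _).
Qed.

(** [s0] is the intended amplitude of the target and [s] the norm of the whole good part,
    contaminated by at most [dlt]. The rotation misses its end by at most [2 eta], and the target
    holds a fraction at least [1 - eta ^+ 2] of the good weight. *)
Lemma amplified_prob_ge (c0 s0 c s al dlt : R) m :
  c0 ^+ 2 + s0 ^+ 2 = 1 -> c ^+ 2 + s ^+ 2 = 1 ->
  0 <= c0 -> 0 <= s0 -> 0 <= c -> 0 <= s -> 0 <= dlt ->
  (c0 +i* s0) ^+ m = 0 +i* 1 ->
  s0 ^+ 2 <= s ^+ 2 <= s0 ^+ 2 + dlt ^+ 2 ->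
  al * s = complex.Im ((c +i* s) ^+ m) ->
  1 - 5 * (m%:R * dlt) <= al ^+ 2 * s0 ^+ 2.
Proof.
move=> cs0 cs c00 s00 cp sp d0 z0m /andP[ss1 ss2] als.
have m0 : 0 <= m%:R :> R by [].
set eta := m%:R * dlt; have e0 : 0 <= eta by rewrite mulr_ge0.
case: (leP (1 - 5 * eta) 0) => [h|]; first by apply: le_trans h _; rewrite mulr_ge0 ?sqr_ge0.
move=> eta1.
have le_s : s0 <= s by rewrite -ler_sqr ?nnegrE.
have le_sd : s <= s0 + dlt.
  rewrite -ler_sqr ?nnegrE ?addr_ge0 //; apply: le_trans ss2 _.
  by rewrite sqrrD -addrA lerD2l lerDr mulrn_wge0 // mulr_ge0.
have le_c : c <= c0 by rewrite -ler_sqr ?nnegrE //; lra.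
have le_cd : c0 <= c + dlt.
  rewrite -ler_sqr ?nnegrE ?addr_ge0 //; apply: (@le_trans _ _ (c ^+ 2 + dlt ^+ 2)); first lra.
  by rewrite sqrrD -addrA lerD2l lerDr mulrn_wge0 // mulr_ge0.
have pert := Im_pow_perturb m cs cs0; rewrite z0m -als /= in pert.
have {}pert : `|al * s - 1| <= 2 * eta.
  apply: le_trans pert _; rewrite /eta mulrCA ler_wpM2l //.
  by rewrite ler0_norm ?ger0_norm; lra.
have as1 : 1 - 2 * eta <= al * s by move: pert; rewrite ler_norml => /andP[]; lra.
(* The number and its conjugate are [2 s0] apart, while the imaginary parts of their [m]-th powers
   are 1 and -1. This makes [dlt] small relative to [s0]. *)
have ms0 : 1 <= m%:R * s0.
  have cs0N : c0 ^+ 2 + (- s0) ^+ 2 = 1 by rewrite sqrrN.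
  have := Im_pow_perturb m cs0 cs0N; rewrite -[c0 -i* s0]/((c0 +i* s0)^*) -rmorphXn z0m /=.
  rewrite subrr normr0 add0r opprK.
  by rewrite !ger0_norm ?addr_ge0 //; lra.
have d_s0 : dlt ^+ 2 <= eta ^+ 2 * s0 ^+ 2.
  rewrite -exprMn lerXn2r ?nnegrE ?mulr_ge0 //.
  by rewrite /eta mulrAC ler_peMl.
have s0s : (1 - eta ^+ 2) * s ^+ 2 <= s0 ^+ 2.
  rewrite mulrBl mul1r lerBlDr; apply: le_trans ss2 _; rewrite lerD2l.
  by apply: le_trans d_s0 _; rewrite ler_wpM2l ?sqr_ge0.
apply: (@le_trans _ _ ((1 - 2 * eta) ^+ 2 * (1 - eta ^+ 2))).
  have e2 := sqr_ge0 eta; have : eta ^+ 2 <= eta by rewrite expr2 ler_piMl //; lra.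
  by move=> ?; nra.
apply: (@le_trans _ _ ((al * s) ^+ 2 * (1 - eta ^+ 2))).
  rewrite ler_wpM2r //; first by rewrite subr_ge0 expr_le1 //; lra.
  by rewrite lerXn2r ?nnegrE //; lra.
by rewrite exprMn -mulrA ler_wpM2l ?sqr_ge0 // mulrC.
Qed.

End Amplification.

(** * The circuit *)

Section Algorithm.
Variable R : realType.
Local Notation C := R[i].

Definition proj_mx n (q : pred 'I_n) : 'M[C]_n := diag_mx (\row_i (q i)%:R).

Lemma proj_mxE n (q : pred 'I_n) (v : 'cV[C]_n) i :
  (proj_mx q *m v) i ord0 = (q i)%:R * v i ord0.
Proof. by rewrite /proj_mx mul_diag_mx !mxE. Qed.

Lemma proj_mx_idem n (q : pred 'I_n) (v : 'cV[C]_n) :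
  proj_mx q *m (proj_mx q *m v) = proj_mx q *m v.
Proof.
by apply/colP=> i; rewrite !proj_mxE mulrA; case: (q i); rewrite ?mul1r ?mul0r.
Qed.

Lemma sign_gate_proj n (q : pred 'I_n) : sign_gate R q = 1%:M - 2 *: proj_mx q.
Proof.
apply/matrixP=> i j; rewrite !mxE; case: eqP => _; last by rewrite !mulr0n mulr0 subr0.
by case: (q i); rewrite /= ?expr1 ?expr0 ?mulr1n ?mulr0n; ring.
Qed.

Lemma sign_gate_predC1 n (i : 'I_n) :
  sign_gate R (predC1 i) = 2 *: (delta_mx i (ord0 : 'I_1) *m adjmx (delta_mx i ord0)) - 1%:M.
Proof.
have -> : adjmx (delta_mx i (ord0 : 'I_1) : 'M[C]__) = delta_mx ord0 i.
  by apply/matrixP=> a b; rewrite adjmxE !mxE conjc_nat andbC.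
rewrite mul_delta_mx; apply/matrixP=> a b; rewrite !mxE /=.
case: (eqVneq a b) => [<-|nab]; rewrite ?andbb ?mulr1n ?mulr0n.
  by case: (a == i); rewrite /= ?expr1 ?expr0; ring.
have -> : (a == i) && (b == i) = false.
  by apply/andP=> -[/eqP ai /eqP bi]; rewrite ai bi eqxx in nab.
by rewrite mulr0 subr0.
Qed.

Lemma unitary_norm n (U : 'M[C]_n) (v : 'cV[C]_n) : unitary U ->
  adjmx (U *m v) *m (U *m v) = adjmx v *m v.
Proof. by move=> [_ UU]; rewrite adjmxM -mulmxA (mulmxA _ U) UU mul1mx. Qed.

Lemma adjmx_delta_mul n (i : 'I_n) (v : 'cV[C]_n) :
  adjmx (delta_mx i ord0) *m v = (v i ord0)%:M.
Proof.
apply/matrixP=> a b; rewrite !ord1 !mxE (bigD1 i) //= adjmxE mxE !eqxx conjc1 mul1r.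
rewrite big1 ?addr0 ?mulr1n // => j /negPf ji.
by rewrite adjmxE mxE ji conjc0 mul0r.
Qed.

Lemma mulmx_deltaE m n (M : 'M[C]_(m, n)) i k :
  (M *m delta_mx i (ord0 : 'I_1)) k ord0 = M k i.
Proof.
rewrite mxE (bigD1 i) //= mxE !eqxx mulr1 big1 ?addr0 // => j /negPf ji.
by rewrite mxE ji mulr0.
Qed.

Lemma cquery_unitary N (U : 'M[C]_N) b anc : unitary U -> unitary (cquery U b anc).
Proof.
move=> uU; apply: unitary_tens; last exact: unitary1.
have [V1 V2] : unitary (if b then adjmx U else U).
  by case: b => //; apply: unitary_adj.
move: (if b then _ else _) V1 V2 => V V1 V2; rewrite /unitary /adjmx.
rewrite map_block_mx tr_block_mx map_mx1 trmx1 !raddf0 -/(adjmx V).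
by rewrite !mulmx_block !mul0mx !mulmx0 !mul1mx !addr0 !add0r V1 V2 -scalar_mx_block.
Qed.

(** [z] indexes [|0>], [f0] is the idle counter value, [v] is the counter state prepared, [w] the
    one projected on, and [md f] the iteration count in branch [f]. *)
Variables (N L : nat) (z : 'I_N) (f0 : 'I_L) (v w : 'I_L -> R) (md : 'I_L -> nat).
Hypotheses (z0 : nat_of_ord z = 0) (f00 : nat_of_ord f0 = 0).
Hypotheses (v0 : v f0 = 0) (w0 : w f0 = 0).
Hypotheses (v1 : \sum_f v f ^+ 2 = 1) (w1 : \sum_f w f ^+ 2 = 1).

Local Notation D := ((N + N) * (N * L))%N.
Local Notation anc := (N * L)%N.
Local Notation e0 := (delta_mx z ord0 : 'cV[C]_N).
Local Notation o0 := (ws_index true z z f0).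

Lemma ket0_delta : ket0 R N = e0.
Proof. by apply/colP=> i; rewrite !mxE eqxx andbT -val_eqE /= z0. Qed.

(** The marked projector is the one onto [U^dagger |a>], whose overlap with the start vector [|0>]
    is the amplitude of [a]. *)
Definition row_grover (U : 'M[C]_N) (a : 'I_N) : 'M[C]_N :=
  grover e0 (adjmx U *m proj_mx (pred1 a) *m U).

Definition unit_of_amp (x : R) : C := Num.sqrt (1 - x ^+ 2) +i* x.

Lemma row_grover_overlap U a (x : R) k : unitary U -> 0 <= x <= 1 ->
  (U *m e0) a ord0 = x%:C ->
  (iter k (mulmx (row_grover U a)) e0) z ord0 =
    (complex.Re ((unit_of_amp x ^+ 2) ^+ k))%:C.
Proof.
move=> uU /andP[x0 x1] Ua; have [U1 U2] := uU.
pose P := adjmx U *m proj_mx (pred1 a) *m U; pose g := P *m e0.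
have cs : Num.sqrt (1 - x ^+ 2) ^+ 2 + x ^+ 2 = 1.
  by rewrite sqr_sqrtr ?subrK // subr_ge0 expr_le1.
have ne0 : adjmx e0 *m e0 = 1%:M.
  by rewrite adjmx_delta_mul mxE !eqxx.
have PP : P *m g = g.
  rewrite /g /P -!mulmxA; congr (_ *m _).
  by rewrite (mulmxA U (adjmx U)) U1 mul1mx proj_mx_idem.
have gz : g z ord0 = (x ^+ 2)%:C.
  have -> : g = x%:C *: (adjmx U *m delta_mx a ord0).
    rewrite /g /P -!mulmxA scalemxAr; congr (_ *m _); apply/colP=> i.
    rewrite proj_mxE !mxE eqxx andbT /=; case: eqP => [->|_]; last by rewrite mul0r mulr0.
    by rewrite -Ua mxE mul1r mulr1.
  rewrite mxE; have -> : (adjmx U *m delta_mx a (ord0 : 'I_1)) z ord0 = ((U *m e0) a ord0)^*.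
    by rewrite !mulmx_deltaE adjmxE.
  by rewrite Ua conjc_real -rmorphM expr2.
have e0g : adjmx e0 *m g = ((x ^+ 2)%:C)%:M by rewrite adjmx_delta_mul gz.
have [al [be [-> E]]] := grover_power k ne0 e0g erefl PP cs.
clear e0g PP; clearbody g; rewrite !mxE gz !eqxx /=.
(* The overlap [al x^2 + be (1 - x^2)] is the real part of the rotated point times the conjugate of
   the starting point, which turns angle [(2 k + 1) theta] into [2 k theta]. *)
have -> : (unit_of_amp x ^+ 2) ^+ k = unit_of_amp x ^+ k.*2.+1 * (unit_of_amp x)^*.
  rewrite -exprM mul2n exprSr -mulrA mulcJ_unit ?mulr1 //; exact: normc_unit.
rewrite -E /=; apply/eqP; rewrite eq_complex /= -!expr2.
move: cs; set c := Num.sqrt _ => cs.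
apply/andP; split; apply/eqP; last by ring.
have c2 : 1 - x ^+ 2 = c ^+ 2 by rewrite -cs addrK.
by rewrite !(mul0r, mulr0, subr0, oppr0) c2; ring.
Qed.

(** One Grover iteration, active in branches with [j < md f]. Elsewhere both sign gates are trivial
    and the two queries cancel, so only the sign gates depend on the counter. *)
Definition filter_layer (j : nat) (U : 'M[C]_N) : 'M[C]_D :=
  ctrl_sign_gate R (fun b _ f => (b != z) && (j < md f)%N) *m
  (cquery U true anc *m
   (ctrl_sign_gate R (fun b a f => (b == a) && (j < md f)%N) *m
    cquery U false anc)).

Lemma sign_gate0 n : sign_gate R (fun _ : 'I_n => false) = 1%:M.
Proof. by apply/matrixP=> i j; rewrite !mxE. Qed.

Lemma eq_sign_gate n (p q : pred 'I_n) : p =1 q -> sign_gate R p = sign_gate R q.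
Proof. by move=> pq; apply/matrixP=> i j; rewrite !mxE pq. Qed.

Lemma filter_layer_state j U g : unitary U ->
  filter_layer j U *m ws_state g =
  ws_state (fun a (f : 'I_L) => if (j < md f)%N then row_grover U a *m g a f else g a f).
Proof.
move=> [U1 U2]; rewrite /filter_layer -!mulmxA cquery_ws_state ctrl_sign_gate_ws_state.
rewrite cquery_ws_state ctrl_sign_gate_ws_state; apply: eq_ws_state => a f /=.
case: (ltnP j (md f)) => _.
  rewrite (@eq_sign_gate _ (fun b => (b != z) && true) (predC1 z)) => [|b]; last by rewrite andbT.
  rewrite (@eq_sign_gate _ (fun b => (b == a) && true) (pred1 a)) => [|b]; last by rewrite andbT.
  rewrite sign_gate_predC1 sign_gate_proj /row_grover /grover -!mulmxA; congr (_ *m _).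
  rewrite !mulmxBl !mul1mx mulmxBr (mulmxA (adjmx U) U) U2 mul1mx; congr (_ - _).
  by rewrite -!scalemxAl -!scalemxAr !mulmxA.
rewrite (@eq_sign_gate _ (fun b => (b != z) && false) (fun=> false)) => [|b]; last by rewrite andbF.
rewrite (@eq_sign_gate _ (fun b => (b == a) && false) (fun=> false)) => [|b]; last by rewrite andbF.
by rewrite sign_gate0 !mul1mx mulmxA U2 mul1mx.
Qed.

Fixpoint filter_circuit (d : nat) (U : 'M[C]_N) : 'M[C]_D :=
  if d is d'.+1 then filter_layer d' U *m filter_circuit d' U else 1%:M.

Lemma filter_circuit_state d U g : unitary U ->
  filter_circuit d U *m ws_state g =
  ws_state (fun a f => iter (minn d (md f)) (mulmx (row_grover U a)) (g a f)).
Proof.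
move=> uU; elim: d => [|d IH] /=.
  by rewrite mul1mx; apply: eq_ws_state => a f; rewrite min0n.
rewrite -mulmxA IH filter_layer_state //; apply: eq_ws_state => a f.
case: (leqP (md f) d) => h; last by rewrite (minn_idPl h).
by rewrite (minn_idPr (leqW h)).
Qed.

(** Since the last exchange gate is symmetric with column [f0] equal to [w], reading the counter at
    [f0] afterwards takes the inner product with [w]. *)
Definition prep_circuit (d : nat) (U : 'M[C]_N) : 'M[C]_D :=
  counter_gate N (exchange_gate f0 w) *m (filter_circuit d U *m
  (counter_gate N (exchange_gate f0 v) *m (swap_gate R N L *m cquery U false anc))).

Lemma delta_ws_state : (delta_mx o0 ord0 : 'cV[C]_D) =
  ws_state (fun a f => ((a == z) && (f == f0))%:R *: e0).
Proof.
apply: ws_stateP => c b a f; rewrite !mxE eqxx !andbT ws_index_inj.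
by case: c => //=; case: (b == z); case: (a == z); case: (f == f0);
  rewrite ?mulr1 ?mulr0.
Qed.

Definition filter_value (x : R) : R :=
  \sum_f v f * w f * complex.Re ((unit_of_amp x ^+ 2) ^+ md f).

Lemma prep_circuit_amp d U (x : 'I_N -> R) a : unitary U ->
  (forall f, (md f <= d)%N) ->
  (forall y, 0 <= x y <= 1) -> (forall y, (U *m e0) y ord0 = (x y)%:C) ->
  (prep_circuit d U *m delta_mx o0 (ord0 : 'I_1)) (ws_index true z a f0) ord0 =
  (x a * filter_value (x a))%:C.
Proof.
move=> uU mdd x01 Ux; rewrite /prep_circuit delta_ws_state -!mulmxA.
rewrite cquery_ws_state swap_gate_ws_state counter_gate_ws_state.
(* Before filtering, branch [(a, f)] carries amplitude [v f * x a] with the system in [|0>]. *)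
have -> : ws_state (fun a f => \sum_f' exchange_gate f0 v f f' *:
      \col_b (U *m (((b == z) && (f' == f0))%:R *: e0)) a ord0) =
    ws_state (fun a f => (v f * x a)%:C *: e0).
  apply: eq_ws_state => a' f; rewrite (bigD1 f0) //= big1 ?addr0; last first.
    move=> f' /negPf nf; apply/colP=> b.
    by rewrite mxE [X in _ * X]mxE nf andbF scale0r mulmx0 !mxE mulr0.
  rewrite exchange_gate_col // rmorphM -scalerA; congr (_ *: _).
  apply/colP=> b; rewrite mxE -scalemxAr mxE Ux [RHS]mxE [X in _ = _ * X]mxE.
  by rewrite !eqxx mulrC.
rewrite filter_circuit_state // counter_gate_ws_state ws_stateE summxE.
rewrite /filter_value mulr_sumr rmorph_sum; apply: eq_bigr => f _.
have -> : iter (minn d (md f)) (mulmx (row_grover U a)) ((v f * x a)%:C *: e0) =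
  (v f * x a)%:C *: iter (md f) (mulmx (row_grover U a)) e0.
  rewrite (minn_idPr (mdd f)); elim: (md f) => //= k ->; by rewrite -scalemxAr.
rewrite mxE [X in _ * X]mxE (row_grover_overlap _ uU (x01 a) (Ux a)).
rewrite exchange_gate_sym exchange_gate_col // -!rmorphM; congr (_%:C).
by ring.
Qed.

Lemma filter_layer_impl j : implementable 2 (filter_layer j).
Proof.
do 2!(apply: implementable_gate_mul; first exact: sign_gate_unitary;
  try apply: implementable_query_mul); exact: implementable_query.
Qed.

Lemma filter_circuit_impl d : implementable (d * 2) (filter_circuit d).
Proof.
elim: d => [|d IH] /=; first exact/implementable_gate/unitary1.
by rewrite mulSn addnC; apply: implementable_mul IH (filter_layer_impl d).
Qed.

Lemma prep_circuit_impl d : implementable (d * 2).+1 (prep_circuit d).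
Proof.
apply: implementable_gate_mul; first exact/counter_gate_unitary/exchange_gate_unitary.
rewrite -add1n; apply: implementable_mul (filter_circuit_impl d).
apply: implementable_gate_mul; first exact/counter_gate_unitary/exchange_gate_unitary.
apply: implementable_gate_mul; first exact: swap_gate_unitary.
exact: implementable_query.
Qed.

Lemma prep_circuit_unitary d U : unitary U -> unitary (prep_circuit d U).
Proof.
move=> uU; apply: unitaryM; first exact/counter_gate_unitary/exchange_gate_unitary.
apply: unitaryM.
  elim: d => [|d IH] /=; first exact: unitary1.
  apply: unitaryM => //; apply: unitaryM; first exact: sign_gate_unitary.
  apply: unitaryM; first exact: cquery_unitary.
  by apply: unitaryM; [exact: sign_gate_unitary | exact: cquery_unitary].
apply: unitaryM; first exact/counter_gate_unitary/exchange_gate_unitary.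
by apply: unitaryM; [exact: swap_gate_unitary | exact: cquery_unitary].
Qed.

(** The ancilla is left free: the flag certifies that the filter was passed without knowing the
    target label. *)
Definition good (o : 'I_D) : bool :=
  [&& ws_ctrl o, ws_sys o == z & ws_cnt o == f0].

Definition amp_step (d : nat) (U : 'M[C]_N) : 'M[C]_D :=
  prep_circuit d U *m (sign_gate R (predC1 o0) *m
   (adjmx (prep_circuit d U) *m sign_gate R good)).

Definition amp_circuit (d k : nat) (U : 'M[C]_N) : 'M[C]_D :=
  iter k (mulmx (amp_step d U)) (prep_circuit d U *m flip_gate R N L).

(** Each amplification step runs the preparation once forwards and once backwards, at [2 d + 1]
    queries each. *)
Lemma amp_circuit_impl d k : implementable (k.*2.+1 * (d * 2).+1) (amp_circuit d k).
Proof.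
have iA := prep_circuit_impl d.
elim: k => [|k IH].
  rewrite mul1n -[X in implementable X _]add0n.
  by apply: (implementable_mul _ iA); apply/implementable_gate/flip_gate_unitary.
have -> : (k.+1.*2.+1 * (d * 2).+1 = k.*2.+1 * (d * 2).+1 + ((d * 2).+1 + (d * 2).+1))%N.
  by lia.
apply: implementable_mul IH _; rewrite /amp_step.
apply: (implementable_mul _ iA); apply: implementable_gate_mul; first exact: sign_gate_unitary.
rewrite -[X in implementable X _]add0n.
apply: implementable_mul (implementable_adj iA).
exact/implementable_gate/sign_gate_unitary.
Qed.

Lemma amp_step_grover d U : unitary U -> amp_step d U =
  grover (prep_circuit d U *m delta_mx o0 (ord0 : 'I_1)) (proj_mx good).
Proof.
move=> uU; have [A1 A2] := prep_circuit_unitary d uU.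
rewrite /amp_step /grover sign_gate_predC1 sign_gate_proj !mulmxA; congr (_ *m _).
rewrite mulmxBr mulmxBl mulmx1 A1; congr (_ - _).
by rewrite -scalemxAr -scalemxAl adjmxM !mulmxA.
Qed.

Lemma amp_circuit_state d k U : unitary U -> amp_circuit d k U *m ket0 R D =
  iter k (mulmx (grover (prep_circuit d U *m delta_mx o0 (ord0 : 'I_1)) (proj_mx good)))
    (prep_circuit d U *m delta_mx o0 (ord0 : 'I_1)).
Proof.
move=> uU; rewrite /amp_circuit amp_step_grover //; elim: k => [|k IH] /=.
  by rewrite -mulmxA (flip_gate_ket0 _ z0 f00).
by rewrite -mulmxA IH.
Qed.

Lemma good_weight (Psi : 'cV[C]_D) (y : 'I_N -> R) :
  (forall a, Psi (ws_index true z a f0) ord0 = (y a)%:C) ->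
  adjmx Psi *m (proj_mx good *m Psi) = ((\sum_a y a ^+ 2)%:C)%:M.
Proof.
move=> Py; apply/matrixP=> i j; rewrite !ord1 mxE [RHS]mxE mulr1n rmorph_sum.
rewrite (bigID good) /= [X in _ + X]big1 ?addr0; last first.
  by move=> o /negPf ng; rewrite proj_mxE ng mul0r mulr0.
rewrite (reindex_onto (fun a => ws_index true z a f0) (@ws_anc N L)) /=; last first.
  by move=> o /and3P[co /eqP so /eqP no]; rewrite -{2}(ws_unindexK o) co so no.
apply: eq_big => a; rewrite /good; have [-> -> -> ->] := ws_indexK true z a f0.
  by rewrite !eqxx.
move=> _; rewrite proj_mxE adjmxE Py conjc_real /good.
have [-> -> _ ->] := ws_indexK true z a f0.
by rewrite !eqxx mul1r -rmorphM expr2.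
Qed.

Lemma amp_circuit_prob d k U (x : 'I_N -> R) x1 (c1 s1 dlt : R) : unitary U ->
  (forall f, (md f <= d)%N) ->
  (forall y, 0 <= x y) -> \sum_y x y ^+ 2 = 1 ->
  (forall y, (U *m ket0 R N) y ord0 = (x y)%:C) ->
  c1 ^+ 2 + s1 ^+ 2 = 1 -> 0 <= c1 -> 0 <= s1 -> (c1 +i* s1) ^+ k.*2.+1 = 0 +i* 1 ->
  x x1 * filter_value (x x1) = s1 -> 0 <= dlt ->
  (forall y, y != x1 -> `|filter_value (x y)| <= dlt) ->
  (1 - 5 * (k.*2.+1%:R * dlt))%:C <=
    `|(amp_circuit d k U *m ket0 R D) (ws_index true z x1 f0) ord0| ^+ 2.
Proof.
move=> uU mdd x0 x2 Ux cs1 c10 s10 z1m peak d0 off.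
rewrite ket0_delta in Ux.
have x01 y : 0 <= x y <= 1.
  rewrite x0 /= -(@expr_le1 _ 2) // -x2 (bigD1 y) //= lerDl sumr_ge0 // => i _.
  exact: sqr_ge0.
rewrite amp_circuit_state //; set Psi := prep_circuit d U *m _.
have Pa a := prep_circuit_amp a uU mdd x01 Ux; rewrite -/Psi in Pa.
pose S := \sum_a (x a * filter_value (x a)) ^+ 2.
have gw := good_weight Pa; rewrite -/S in gw.
have nPsi : adjmx Psi *m Psi = 1%:M.
  rewrite unitary_norm; last exact: prep_circuit_unitary.
  by rewrite adjmx_delta_mul mxE !eqxx.
have S0 : 0 <= S by apply: sumr_ge0 => a _; apply: sqr_ge0.
have S_ge : s1 ^+ 2 <= S.
  rewrite /S (bigD1 x1) //= peak lerDl sumr_ge0 // => i _; exact: sqr_ge0.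
(* The off-peak terms are filter values squared, weighted by probabilities of total mass at most
   1. *)
have S_le : S <= s1 ^+ 2 + dlt ^+ 2.
  rewrite /S (bigD1 x1) //= peak lerD2l.
  apply: (@le_trans _ _ (\sum_(i | i != x1) x i ^+ 2 * dlt ^+ 2)).
    apply: ler_sum => i ix; rewrite exprMn ler_wpM2l ?sqr_ge0 //.
    by rewrite -[X in X <= _]real_normK ?num_real // lerXn2r ?nnegrE ?off.
  rewrite -mulr_suml ler_piMl ?sqr_ge0 // -x2 [X in _ <= X](bigD1 x1) //=.
  by rewrite lerDr sqr_ge0.
(* [S] is the squared norm of a projection of a unit vector, so [sqrt (1 - S)] is a genuine
   cosine. *)
have S1 : S <= 1.
  have := congr1 (fun M : 'M[C]_1 => M ord0 ord0) nPsi.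
  have := congr1 (fun M : 'M[C]_1 => M ord0 ord0) gw.
  rewrite !mxE eqxx !mulr1n => gwE nE; rewrite -lecR -gwE -[1%:C]nE.
  apply: ler_sum => o _; rewrite proj_mxE adjmxE.
  have : 0 <= (Psi o ord0)^* * Psi o ord0 by rewrite mulrC mulcJ_ge0.
  by case: (good o); rewrite ?mul1r // mul0r mulr0.
have sS : Num.sqrt S ^+ 2 = S by rewrite sqr_sqrtr.
have cs : Num.sqrt (1 - S) ^+ 2 + Num.sqrt S ^+ 2 = 1.
  by rewrite sqr_sqrtr ?subr_ge0 // sS subrK.
have gw' : adjmx Psi *m (proj_mx good *m Psi) = ((Num.sqrt S ^+ 2)%:C)%:M by rewrite sS.
have [al [be [-> E]]] := grover_power k nPsi gw' erefl (proj_mx_idem _ _) cs.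
have -> : (al%:C *: (proj_mx good *m Psi) + be%:C *: (Psi - proj_mx good *m Psi))
    (ws_index true z x1 f0) ord0 = (al * s1)%:C.
  have gx : good (ws_index true z x1 f0).
    by rewrite /good; have [-> -> _ ->] := ws_indexK true z x1 f0; rewrite !eqxx.
  have := Pa x1; rewrite peak => Px1.
  have gP : (proj_mx good *m Psi) (ws_index true z x1 f0) ord0 = s1%:C.
    by rewrite proj_mxE gx mul1r.
  move: (Psi) (proj_mx good *m Psi) gP Px1 => Q g gP Px1.
  rewrite !mxE gP Px1 subrr mulr0 addr0.
  by rewrite rmorphM.
have -> : `|(al * s1)%:C| ^+ 2 = (al ^+ 2 * s1 ^+ 2)%:C.
  by rewrite sqr_normc conjc_real -rmorphM -expr2 exprMn.
rewrite lecR; apply: (@amplified_prob_ge R c1 s1 (Num.sqrt (1 - S)) (Num.sqrt S)) => //.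
- by rewrite sqrtr_ge0.
- by rewrite sqrtr_ge0.
- by rewrite sS S_ge.
- by rewrite -E.
Qed.

End Algorithm.

(** * Choice of parameters *)

(* Slot 0 is the idle counter value; slots 1 and 2 absorb the missing norm of
   [v] and [w] without contributing to their inner product. *)
Lemma pad_unit_vectors (R : rcfType) (F : finType) (v w : F -> R) (md : F -> nat) d :
  \sum_f v f ^+ 2 <= 1 -> \sum_f w f ^+ 2 <= 1 -> (forall f, (md f <= d)%N) ->
  exists l (f0 : 'I_l) (v' w' : 'I_l -> R) (md' : 'I_l -> nat),
  [/\ nat_of_ord f0 = 0, v' f0 = 0 /\ w' f0 = 0,
      \sum_i v' i ^+ 2 = 1 /\ \sum_i w' i ^+ 2 = 1,
      forall i, (md' i <= d)%N &
      forall h : nat -> R, \sum_i v' i * w' i * h (md' i) = \sum_f v f * w f * h (md f)].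
Proof.
move=> v1 w1 mdd.
pose ext (A : Type) (p : nat -> A) (g : F -> A) (i : 'I_(3 + #|F|)) :=
  match split i with inl j => p j | inr k => g (enum_val k) end.
have extE (h : 'I_(3 + #|F|) -> R) (h0 : nat -> R) (h1 : F -> R) :
    (forall j, h (lshift _ j) = h0 j) -> (forall k, h (rshift _ k) = h1 (enum_val k)) ->
    \sum_i h i = h0 0 + h0 1 + h0 2 + \sum_f h1 f.
  move=> e0 e1; rewrite big_split_ord /= !big_ord_recl big_ord0 !e0 addr0 !addrA.
  by congr (_ + _); rewrite (eq_bigr _ (fun k _ => e1 k)) (big_enum_val h1).
pose pv (j : nat) := if j == 1 then Num.sqrt (1 - \sum_f v f ^+ 2) else 0.
pose pw (j : nat) := if j == 2 then Num.sqrt (1 - \sum_f w f ^+ 2) else 0.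
have extl (A : Type) p g j : @ext A p g (lshift _ j) = p j.
  by rewrite /ext (unsplitK (inl j)).
have extr (A : Type) p g k : @ext A p g (rshift _ k) = g (enum_val k).
  by rewrite /ext (unsplitK (inr k)).
exists (3 + #|F|)%N, (lshift #|F| (ord0 : 'I_3)), (ext _ pv v), (ext _ pw w),
  (ext _ (fun=> 0%N) md).
split; [by [] | by rewrite !extl | split | |].
- rewrite (extE _ (fun j => pv j ^+ 2) (fun f => v f ^+ 2)) => [|j|k]; rewrite ?extl ?extr //.
  by rewrite /pv /= sqr_sqrtr ?subr_ge0 // expr0n /= add0r addr0 subrK.
- rewrite (extE _ (fun j => pw j ^+ 2) (fun f => w f ^+ 2)) => [|j|k]; rewrite ?extl ?extr //.
  by rewrite /pw /= sqr_sqrtr ?subr_ge0 // expr0n /= !add0r subrK.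
- by move=> i; rewrite /ext; case: (split i).
- move=> h.
  rewrite (extE _ (fun j => pv j * pw j * h 0) (fun f => v f * w f * h (md f))) => [|j|k];
    rewrite ?extl ?extr //.
  by rewrite /pv /pw /= !(mul0r, mulr0, add0r).
Qed.

Section ParameterChoice.
Variable R : realType.
Local Notation C := R[i].

Lemma card_counters K r : #|{: counters K r}| = (K ^ r * K ^ r)%N.
Proof. by rewrite card_ffun card_prod !card_ord expnMn. Qed.

Lemma unit_of_ampE (x : R) : 0 <= x <= 1 ->
  Num.sqrt (1 - x ^+ 2) ^+ 2 + x ^+ 2 = 1.
Proof.
by move=> /andP[x0 x1]; rewrite sqr_sqrtr ?subrK // subr_ge0 expr_le1.
Qed.

Lemma normc_unit_of_amp (x : R) : 0 <= x <= 1 -> `|unit_of_amp x| = 1.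
Proof. by move=> /unit_of_ampE; apply: normc_unit. Qed.

Lemma filter_vectors K r (psi lam : R) : (0 < K)%N -> 0 < psi <= 1 -> 0 <= lam <= 1 ->
  exists l (f0 : 'I_l) (v w : 'I_l -> R) (md : 'I_l -> nat),
  [/\ nat_of_ord f0 = 0, v f0 = 0 /\ w f0 = 0,
      \sum_i v i ^+ 2 = 1 /\ \sum_i w i ^+ 2 = 1,
      forall i, (md i <= r * K)%N &
      forall x, filter_value v w md x =
        lam * peak_filter K r (unit_of_amp psi ^+ 2) (unit_of_amp x ^+ 2)].
Proof.
move=> K0 /andP[psi0 psi1] /andP[lam0 lam1].
have Kr : (K ^ r)%:R != 0 :> R by rewrite pnatr_eq0 -lt0n expn_gt0 K0.
pose F : finType := counters K r.
pose z1 := unit_of_amp psi ^+ 2.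
have nz1 : `|z1| = 1.
  by rewrite normrX normc_unit_of_amp ?expr1n // (ltW psi0).
(* There are [K ^ r * K ^ r] counters, so both vectors have norm at most 1; the deficit, including
   the factor [lam], is absorbed by padding. *)
pose v (f : F) := lam / (K ^ r)%:R.
pose w (f : F) := complex.Re (z1 ^+ counter_dist f) / (K ^ r)%:R.
have sum1 : \sum_(f : F) ((K ^ r)%:R ^+ 2)^-1 = 1 :> R.
  by rewrite sumr_const card_counters -[LHS]mulr_natr natrM -expr2 mulVf // expf_neq0.
have v1 : \sum_f v f ^+ 2 <= 1.
  rewrite -sum1; apply: ler_sum => f _; rewrite exprMn exprVn ler_piMl ?expr_le1 //.
  by rewrite invr_ge0 sqr_ge0.
have w1 : \sum_f w f ^+ 2 <= 1.
  rewrite -sum1; apply: ler_sum => f _; rewrite exprMn exprVn ler_piMl //.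
    by rewrite invr_ge0 sqr_ge0.
  rewrite -real_normK ?num_real // expr_le1 //.
  by rewrite -lecR; apply: le_trans (normc_ge_Re _) _; rewrite normrX nz1 expr1n.
have [l [f0 [v' [w' [md [h1 h2 h3 h4 h5]]]]]] :=
  pad_unit_vectors v1 w1 (@counter_dist_le K r).
exists l, f0, v', w', md; split=> // x.
rewrite /filter_value (h5 (fun m => complex.Re ((unit_of_amp x ^+ 2) ^+ m))).
rewrite /peak_filter mulr_sumr; apply: eq_bigr => f _; rewrite /v /w -/z1.
by field.
Qed.

Lemma truncS_itv (x : R) : 0 <= x -> x <= (Num.truncn x).+1%:R <= x + 1.
Proof.
move=> x0; have /andP[h1 h2] := truncn_itv x0.
by rewrite (ltW h2) /= -natr1 lerD2r.
Qed.

(** With [M] the integer just above [y], so [M <= 2 y], take [r = floor (log2 M) + 1]; then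
    [y <= M < 2 ^ r <= 4 ^ r]. *)
Lemma log_rounds (y : R) : 1 <= y -> exists r : nat,
  [/\ (0 < r)%N, 4^-1 ^+ r <= y^-1 & r%:R <= 1 + ln (2 * y) / ln 2].
Proof.
move=> y1; have y0 : 0 <= y by lra.
have /andP[My yM] := truncS_itv y0; set M := (Num.truncn y).+1 in My yM.
have ln20 : 0 < ln 2 :> R by rewrite ln_gt0 // ltr1n.
have /andP[leM ltM] := @trunc_log_bounds 2 M isT isT.
exists (trunc_log 2 M).+1; split=> //.
  rewrite exprVn lef_pV2 ?posrE ?exprn_gt0 //; last by lra.
  apply: le_trans My _; rewrite -natrX ler_nat; apply: ltnW (leq_trans ltM _).
  by rewrite leq_exp2r.
rewrite -natr1 addrC lerD2l ler_pdivlMr // [X in X <= _]mulr_natl -lnXn // -natrX.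
by rewrite ler_ln ?posrE ?ltr0n ?expn_gt0 //; first apply: (@le_trans _ _ M%:R);
  rewrite ?ler_nat //; lra.
Qed.

Lemma query_parameters (eps psi D : R) : 0 < eps <= 1 -> 0 < psi <= 1 -> 0 < D <= 1 ->
  exists k K r : nat,
  [/\ (0 < K)%N, 4 <= D * K%:R, 4 / psi <= k.*2.+1%:R,
      5 * (k.*2.+1%:R * 4^-1 ^+ r) <= eps &
      (k.*2.+1 * ((r * K) * 2).+1)%:R <=
        77 / (psi * D) * (1 + (ln (70 / eps) + ln psi^-1) / ln 2)].
Proof.
move=> /andP[e0 e1] /andP[p0 p1] /andP[D0 D1].
have ip : 1 <= psi^-1 by rewrite invf_ge1.
have iD : 1 <= D^-1 by rewrite invf_ge1.
have ie : 1 <= eps^-1 by rewrite invf_ge1.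
have p20 : 0 <= 2 / psi by rewrite divr_ge0 // ltW.
have D40 : 0 <= 4 / D by rewrite divr_ge0 // ltW.
have /andP[k1 k2] := truncS_itv p20; have /andP[K1 K2] := truncS_itv D40.
set k := (Num.truncn _).+1 in k1 k2; set K := (Num.truncn _).+1 in K1 K2.
(* 35 is 5 from the amplification error times 7 from [2 k + 1 <= 7 / psi]. Together with
   [2 r K + 1 <= 11 r / D] this also gives [77 = 7 * 11], and [70 = 2 * 35]. *)
have y1 : 1 <= 35 * (psi^-1 * eps^-1).
  have : 1 <= psi^-1 * eps^-1 by exact: mulr_ege1.
  by lra.
have [r [r0 r1 r2]] := log_rounds y1.
have mE : k.*2.+1%:R = 2 * k%:R + 1 :> R by rewrite -natr1 -mul2n natrM.
have m7 : k.*2.+1%:R <= 7 * psi^-1 :> R by rewrite mE; lra.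
exists k, K, r; split=> //.
- by rewrite mulrC -ler_pdivrMr.
- by rewrite mE; lra.
- apply: (@le_trans _ _ (5 * (7 * psi^-1 * (35 * (psi^-1 * eps^-1))^-1))).
    by rewrite ler_pM2l // ler_pM // exprn_ge0 // invr_ge0.
  rewrite le_eqVlt; apply/orP; left; apply/eqP; field.
  by rewrite !gt_eqF.
have rR : 1 <= r%:R :> R by rewrite ler1n.
have K5 : K%:R <= 5 * D^-1 :> R by lra.
rewrite natrM; apply: (@le_trans _ _ (7 * psi^-1 * (11 * D^-1 * r%:R))).
  apply: ler_pM => //; rewrite -natr1 !natrM.
  have : r%:R * K%:R <= r%:R * (5 * D^-1) :> R by rewrite ler_pM2l //; lra.
  have : 1 <= r%:R * D^-1 :> R by exact: mulr_ege1.
  by lra.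
have -> : 7 * psi^-1 * (11 * D^-1 * r%:R) = 77 / (psi * D) * r%:R.
  by field; rewrite !gt_eqF.
rewrite ler_pM2l ?divr_gt0 ?mulr_gt0 //.
apply: le_trans r2 _; rewrite -lnM ?posrE ?divr_gt0 ?invr_gt0 //.
have -> : 2 * (35 * (psi^-1 * eps^-1)) = 70 / eps * psi^-1 by field; rewrite !gt_eqF.
by [].
Qed.

End ParameterChoice.

Theorem theorem7 :
  forall (R : realType) (eps : R), 0 < eps ->
  exists (Cst : R) (c : nat), 0 < Cst /\
  forall (n : nat) (psi1 Delta : R), 0 < psi1 -> 0 < Delta ->
  exists A : qalg R (2 ^ n),
    qalg_unitary A /\
    (nq A)%:R <= Cst / (psi1 * Delta) *
                 (ln (2 ^ n)%:R + ln psi1^-1 + ln Delta^-1 + 2) ^+ c /\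
    forall (U : 'M[R[i]]_(2 ^ n)) (a : 'I_(2 ^ n) -> R) (x1 : 'I_(2 ^ n)),
      unitary U ->
      (forall y, (U *m ket0 R (2 ^ n)) y ord0 = (a y)%:C) ->
      (forall y, 0 <= a y) ->
      \sum_y a y ^+ 2 = 1 ->
      a x1 = psi1 ->
      (forall y, y != x1 -> a y <= psi1 - Delta) ->
      (exists2 y, y != x1 & a y = psi1 - Delta) ->
      ((1 - eps)%:C <= success_prob A U x1).
Proof.
move=> R eps eps0.
pose e := Num.min eps 1.
have e01 : 0 < e <= 1 by rewrite lt_min eps0 ltr01 ge_min lexx orbT.
have /andP[e0 e1] := e01.
have ee : e <= eps by rewrite ge_min lexx.
have ln20 : 0 < ln 2 :> R by rewrite ln_gt0 // ltr1n.
have B0 : 0 <= ln (70 / e).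
  by rewrite ln_ge0 // ler_pdivlMr // mul1r; lra.
have B1 : 0 <= (ln (70 / e) + 1) / ln 2 by rewrite divr_ge0 // ?ltW //; lra.
exists (77 * (1 + (ln (70 / e) + 1) / ln 2)), 2%N; split; first by lra.
move=> n psi1 Delta p0 D0.
have N0 : (0 < 2 ^ n)%N by rewrite expn_gt0.
pose z := Ordinal N0.
(* Outside this range no amplitude vector meets the hypotheses, so a circuit without queries will
   do. *)
case: (boolP ((psi1 <= 1) && (Delta <= psi1))) => [/andP[p1 Dp]|invalid]; last first.
  have [A [uA qA _]] := implementable_qalg (fun=> z)
    (implementable_gate (unitary1 R ((2 ^ n + 2 ^ n) * 1))).
  exists A; split=> //; split.
    rewrite qA mulr_ge0 ?sqr_ge0 // divr_ge0 ?mulr_ge0 ?(ltW p0) ?(ltW D0) //; lra.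
  move=> U a x1 _ _ a0 a2 ax1 _ [y _ ay]; case/negP: invalid; apply/andP; split.
    rewrite -ax1 -(@expr_le1 _ 2) // -a2 (bigD1 x1) //= lerDl sumr_ge0 // => i _.
    exact: sqr_ge0.
  by rewrite -subr_ge0 -ay.
have p01 : 0 < psi1 <= 1 by rewrite p0.
have D01 : 0 < Delta <= 1 by rewrite D0 (le_trans Dp).
have [k [K [r [K0 DK mpsi err qb]]]] := query_parameters e01 p01 D01.
set m := k.*2.+1 in mpsi err qb.
have [c1 [s1 [cs1 c10 s10 s1m zm]]] := @quarter_turn_root R m isT.
pose z1 := unit_of_amp psi1 ^+ 2.
have p01' : 0 <= psi1 <= 1 by rewrite ltW.
have nsq x : 0 <= x <= 1 -> `|unit_of_amp x ^+ 2 : R[i]| = 1.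
  by move=> x01; rewrite normrX normc_unit_of_amp ?expr1n.
have nz1 := nsq _ p01'; rewrite -/z1 in nz1.
pose pk := peak_filter K r z1 z1.
have pk2 : 2^-1 <= pk by apply: peak_filter_peak.
have pk0 : 0 < pk by lra.
(* Scales the filtered target amplitude to exactly [s1]. It is at most 1 because
   [s1 <= 2 / m <= psi1 / 2] and [pk >= 1 / 2]. *)
pose lam := s1 / (psi1 * pk).
have pp0 : 0 < psi1 * pk by rewrite mulr_gt0.
have lam01 : 0 <= lam <= 1.
  rewrite divr_ge0 ?(ltW pp0) //= ler_pdivrMr // mul1r.
  apply: le_trans s1m _; apply: (@le_trans _ _ (psi1 / 2)); last by rewrite ler_pM2l.
  have m0 : 0 < m%:R :> R by rewrite ltr0n.
  move: mpsi; rewrite ler_pdivrMr // => mpsi.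
  by rewrite ler_pdivrMr //; lra.
have [l [f0 [v [w [md [f00 [v0 w0] [v1 w1] mdd fv]]]]]] :=
  filter_vectors r K0 p01 lam01.
have [A [uA qA sA]] := implementable_qalg (@ws_anc (2 ^ n) l)
  (amp_circuit_impl (z := z) md erefl f00 v0 w0 v1 w1 (r * K)%N k).
exists A; split=> //; split.
  rewrite qA; apply: le_trans qb _.
  have LN : 0 <= ln (2 ^ n)%:R :> R by rewrite ln_ge0 // ler1n.
  have Lp : 0 <= ln psi1^-1 by rewrite ln_ge0 // invf_ge1.
  have LD : 0 <= ln Delta^-1 by rewrite ln_ge0 // invf_ge1 //; case/andP: D01.
  set lg := ln (2 ^ n)%:R + ln psi1^-1 + ln Delta^-1 + 2.
  have lg1 : 1 <= lg by rewrite /lg; lra.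
  (* As [lg >= 1], its square dominates both the constant term and the term linear in the
     logarithm. *)
  have lg2 : lg <= lg ^+ 2 by rewrite expr2 ler_peMl //; lra.
  rewrite mulrAC [X in _ <= X]mulrAC; apply: ler_wpM2r.
    by rewrite invr_ge0 mulr_ge0 // ltW.
  rewrite -mulrA ler_pM2l // [X in _ <= X]mulrDl mul1r lerD //; first by lra.
  rewrite [X in _ <= X]mulrAC ler_wpM2r ?invr_ge0 ?(ltW ln20) //.
  rewrite [X in _ <= X]mulrDl mul1r lerD //.
    by rewrite ler_peMr //; lra.
  by apply: le_trans lg2; rewrite /lg; lra.
move=> U a x1 uU Ua a0 a2 ax1 gap _.
have a01 y : 0 <= a y <= 1.
  rewrite a0 /= -(@expr_le1 _ 2) // -a2 (bigD1 y) //= lerDl sumr_ge0 // => i _.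
  exact: sqr_ge0.
have d0 : 0 <= 4^-1 ^+ r :> R by rewrite exprn_ge0 // invr_ge0.
have peakE : a x1 * filter_value v w md (a x1) = s1.
  by rewrite ax1 fv -/z1 -/pk mulrCA divfK // gt_eqF.
have off y : y != x1 -> `|filter_value v w md (a y)| <= 4^-1 ^+ r.
  move=> yx; have /andP[lam0 lam1] := lam01; have nzy := nsq _ (a01 y).
  have pg0 := peak_filter_ge0 r K0 nz1 nzy.
  rewrite fv -/z1 ger0_norm; last exact: mulr_ge0.
  apply: le_trans (ler_piMl pg0 lam1) _.
  have gy : Delta <= psi1 - a y by have := gap y yx; lra.
  apply: (peak_filter_off r nz1 nzy D0 DK).
    by apply: angle_gap_sum; rewrite ?unit_of_ampE ?sqrtr_ge0 ?(ltW D0).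
  by apply: angle_gap_diff; rewrite ?unit_of_ampE ?sqrtr_ge0 ?(ltW D0).
have := amp_circuit_prob (z := z) erefl f00 v0 w0 v1 w1 uU mdd a0 a2 Ua cs1 c10 s10 zm
  peakE d0 off.
move=> prob; rewrite sA; apply: le_trans (le_trans prob _).
  by rewrite lecR lerD2l lerN2; apply: le_trans err ee.
(* Among all outcomes whose ancilla reads [x1], the single good one already carries enough
   probability. *)
rewrite (bigD1 (ws_index true z x1 f0)) /=; last first.
  by have [_ _ -> _] := ws_indexK true z x1 f0.
by rewrite lerDl sumr_ge0 // => o _; rewrite exprn_ge0.
Qed.
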